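(* For every integer $m\ge1$ and each of the species $11, 13, 15, 17, 19, 21, 22, 25, 27, 29$ and $30$, there are isonemal fabrics of that species that can be perfectly coloured by thick striping with $2m+1$ colours (the same set of colours for warps and wefts) in such a way that the redundant blocks are arranged as a doubled $2m/1$ twill.
   Context: Cells are unit squares $[i,i+1]\times[j,j+1]$ tessellating the plane; vertical strips are warps, horizontal strips (rows) are wefts. A prefabric assigns to each cell which crossing strand is on top; its design colours a cell dark if the warp is on top; a fabric is a prefabric that does not fall apart. With $\tau$ reflection in the plane of the fabric, the symmetry group $G_1$ consists of pairs $(t,r)$, $t$ a plane isometry preserving the cell tessellation and $r\in\{e,\tau\}$, with $t$ mapping the over/under relation to itself ($r=e$, side-preserving) or its reverse ($r=\tau$); $H_1$ is the side-preserving subgroup. Isonemal: periodic with $G_1$ transitive on all strands; order: the period of the design along a strand. Species: Roth classified the symmetry groups of isonemal prefabrics of order greater than four into 39 types numbered 1–39, each type being the pair (crystallographic type of $G_1$, crystallographic type of $H_1$); ''species $n$'' means the symmetry group is of Roth type $n$ (Thomas's refinement into subspecies such as $17_e$, $27_o$ further subdivides these). Thick striping gives each warp pair $[2a,2a+2]\times\mathbb{R}$ and weft pair $\mathbb{R}\times[2b,2b+2]$ one colour; a block is $[2a,2a+2]\times[2b,2b+2]$, and it is redundant if its warp pair and weft pair have the same colour. The $(c-1)/1$ twill is the order-$c$ design in which, up to a symmetry of the square grid, cell $(i,j)$ is dark exactly when $i-j\equiv0\pmod c$; its double is obtained by replacing each cell by a $2\times2$ block of the same colour. An element $(t,r)\in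 G_1$ is a colour symmetry if for each colour $t$ maps all strands of that colour onto strands of one common colour; the colouring is perfect if every element of $G_1$ is a colour symmetry. *)

(* Defs.v *)
From HB Require Import structures.
From mathcomp Require Import all_boot all_order all_algebra.
Set Implicit Arguments.
Unset Strict Implicit.
Unset Printing Implicit Defensive.
Import Order.TTheory GRing.Theory Num.Theory.
Local Open Scope ring_scope.

(* [Warp i] is the strip [i, i+1] x R and [Weft j] is the strip R x [j, j+1];
   cell (i, j) is their crossing. *)
Inductive strand := Warp of int | Weft of int.

(* A prefabric is given by its design: [W i j] holds iff cell (i, j) is dark,
   i.e. warp i passes over weft j. *)
Definition prefabric := int -> int -> bool.

Definition over (W : prefabric) (s s' : strand) : bool :=
  match s, s' with
  | Warp i, Weft j => W i j
  | Weft j, Warp i => ~~ W i j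
  | _, _ => false
  end.

(* The prefabric falls apart if some of the strands, but not all, can be
   lifted off the others. *)
Definition falls_apart (W : prefabric) : Prop :=
  exists S : strand -> Prop,
    [/\ exists s, S s,
        exists s, ~ S s
      & forall s s', S s -> ~ S s' -> ~~ over W s' s].

Definition fabric (W : prefabric) : Prop := ~ falls_apart W.

(* Isometries of the plane that preserve the tessellation: a signed permutation
   of the coordinates followed by an integral translation. *)
Record grid_isometry := GridIsometry {
  swap : bool;
  negx : bool;
  negy : bool;
  shiftx : int;
  shifty : int
}.

(* Every lattice that occurs below is integral, so rational points suffice. *)
Definition point : Type := (rat * rat)%type.

Definition act_point (t : grid_isometry) (P : point) : point :=
  let: (x, y) := if swap t then (P.2, P.1) else P in
  ((-1) ^+ negx t * x + (shiftx t)%:~R, (-1) ^+ negy t * y + (shifty t)%:~R).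

(* Image of the index of the interval [i, i+1] under z |-> h + z, or under
   z |-> h - z if [neg] holds. *)
Definition act_index (neg : bool) (h i : int) : int :=
  if neg then h - i - 1 else h + i.

Definition act_strand (t : grid_isometry) (s : strand) : strand :=
  match s with
  | Warp i => if swap t then Weft (act_index (negy t) (shifty t) i)
              else Warp (act_index (negx t) (shiftx t) i)
  | Weft j => if swap t then Warp (act_index (negx t) (shiftx t) j)
              else Weft (act_index (negy t) (shifty t) j)
  end.

Definition act_cell (t : grid_isometry) (c : int * int) : int * int :=
  let: (i, j) := if swap t then (c.2, c.1) else c in
  (act_index (negx t) (shiftx t) i, act_index (negy t) (shifty t) j).

Definition on_strand (s : strand) (P : point) : bool :=
  match s with
  | Warp i => (i%:~R <= P.1) && (P.1 <= i%:~R + 1)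
  | Weft j => (j%:~R <= P.2) && (P.2 <= j%:~R + 1)
  end.

Lemma act_strandP (t : grid_isometry) (s : strand) (P : point) :
  on_strand s P -> on_strand (act_strand t s) (act_point t P).
Proof.
have key (neg : bool) (h i : int) (z : rat) :
    (i%:~R <= z) && (z <= i%:~R + 1) ->
    ((act_index neg h i)%:~R <= (-1) ^+ neg * z + h%:~R) &&
    ((-1) ^+ neg * z + h%:~R <= (act_index neg h i)%:~R + 1).
  case/andP=> h1 h2; case: neg; rewrite /act_index /=.
    rewrite expr1 mulN1r !rmorphB /= subrK [- z + _]addrC.
    by rewrite -addrA -opprD !lerD2l !lerN2 h2.
  by rewrite expr0 mul1r rmorphD /= [z + _]addrC -addrA !lerD2l h1.
case: P => x y; case: s => k; rewrite /act_strand /act_point /=;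
  by case: (swap t) => /= H; apply: key.
Qed.

(* An element of the symmetry group is a pair (t, r); [r = false] stands for e
   and [r = true] for tau. *)
Definition inG1 (W : prefabric) (t : grid_isometry) (r : bool) : Prop :=
  forall s s' : strand,
    over W s s' = if r then over W (act_strand t s') (act_strand t s)
                  else over W (act_strand t s) (act_strand t s').

(* (id, tau) is never a symmetry, so the planar part determines an element of
   G1. *)
Definition planarG1 (W : prefabric) (t : grid_isometry) : Prop :=
  exists r, inG1 W t r.

Definition planarH1 (W : prefabric) (t : grid_isometry) : Prop :=
  inG1 W t false.

Definition strand_transitive (Gam : grid_isometry -> Prop) : Prop :=
  forall s s' : strand, exists t, Gam t /\ act_strand t s = s'.

Definition translation (x y : int) : grid_isometry :=
  GridIsometry false false false x y.

Definition is_half_turn (t : grid_isometry) : bool :=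
  [&& ~~ swap t, negx t & negy t].

Definition periodic (W : prefabric) : Prop :=
  exists x y x' y' : int,
    [/\ x * y' - y * x' <> 0,
        planarG1 W (translation x y)
      & planarG1 W (translation x' y')].

Definition isonemal (W : prefabric) : Prop :=
  periodic W /\ strand_transitive (planarG1 W).

Definition along (W : prefabric) (s : strand) (k : int) : bool :=
  match s with Warp i => W i k | Weft j => W k j end.

Definition has_period (u : int -> bool) (p : nat) : Prop :=
  (0 < p)%N /\ forall k : int, u (k + p%:Z) = u k.

Definition has_order (W : prefabric) (p : nat) : Prop :=
  forall s : strand, has_period (along W s) p /\
    forall q : nat, has_period (along W s) q -> (p <= q)%N.

(* Plane crystallographic groups, by the general positions of the International
   Tables; the group consists of these maps followed by the translations in
   Z^2.  Two groups are of the same type iff an affine bijection of the plane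
   conjugates one onto the other. *)
Inductive plane_group := pg | p2 | pmm | pmg | pgg | cmm.

Definition positions (T : plane_group) : seq (point -> point) :=
  let h : rat := 2^-1 in
  match T with
  | pg  => [:: fun P => (P.1, P.2); fun P => (- P.1, P.2 + h)]
  | p2  => [:: fun P => (P.1, P.2); fun P => (- P.1, - P.2)]
  | pmm => [:: fun P => (P.1, P.2); fun P => (- P.1, - P.2);
               fun P => (- P.1, P.2); fun P => (P.1, - P.2)]
  | pmg => [:: fun P => (P.1, P.2); fun P => (- P.1, - P.2);
               fun P => (- P.1 + h, P.2); fun P => (P.1 + h, - P.2)]
  | pgg => [:: fun P => (P.1, P.2); fun P => (- P.1, - P.2);
               fun P => (- P.1 + h, P.2 + h); fun P => (P.1 + h, - P.2 + h)]
  | cmm => [:: fun P => (P.1, P.2); fun P => (- P.1, - P.2);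
               fun P => (- P.1, P.2); fun P => (P.1, - P.2);
               fun P => (P.1 + h, P.2 + h); fun P => (- P.1 + h, - P.2 + h);
               fun P => (- P.1 + h, P.2 + h); fun P => (P.1 + h, - P.2 + h)]
  end.

Definition in_plane_group (T : plane_group) (f : point -> point) : Prop :=
  exists (k : nat) (x y : int), (k < size (positions T))%N /\
    forall P, f P = ((nth id (positions T) k P).1 + x%:~R,
                     (nth id (positions T) k P).2 + y%:~R).

Definition affine_bijection (phi : point -> point) : Prop :=
  exists a b c d e f : rat, a * d - b * c != 0 /\
    forall P, phi P = (a * P.1 + b * P.2 + e, c * P.1 + d * P.2 + f).

Definition of_crystallographic_type
    (Gam : grid_isometry -> Prop) (T : plane_group) : Prop :=
  exists phi, affine_bijection phi /\
    (forall t, Gam t -> exists2 f, in_plane_group T f &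
       forall P, phi (act_point t P) = f (phi P)) /\
    (forall f, in_plane_group T f -> exists2 t, Gam t &
       forall P, phi (act_point t P) = f (phi P)).

Definition types_G1_H1 (W : prefabric) (T T' : plane_group) : Prop :=
  of_crystallographic_type (planarG1 W) T /\
  of_crystallographic_type (planarH1 W) T'.

(* Several of Roth's types share the same pair of crystallographic types.  They
   are told apart by the action on the strands: whether a half-turn of G1 can
   leave a strand invariant (in the types below none does; equivalently, all
   centres of half-turns are corners of cells) and, where both cases occur,
   whether H1 is by itself transitive on the strands. *)
Definition no_half_turn_on_strand (W : prefabric) : Prop :=
  forall t s, planarG1 W t -> is_half_turn t -> act_strand t s <> s.

Definition roth_type (n : nat) (W : prefabric) : Prop :=
  no_half_turn_on_strand W /\
  match n with
  | 11 => types_G1_H1 W pgg pgg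
  | 13 => types_G1_H1 W pgg p2
  | 15 => types_G1_H1 W pgg pg
  | 17 => types_G1_H1 W pmg p2
  | 19 => types_G1_H1 W pmg pg
  | 21 => types_G1_H1 W pmg pgg /\ strand_transitive (planarH1 W)
  | 22 => types_G1_H1 W pmg pgg /\ ~ strand_transitive (planarH1 W)
  | 25 => types_G1_H1 W pmm p2
  | 27 => types_G1_H1 W cmm p2
  | 29 => types_G1_H1 W cmm pgg /\ strand_transitive (planarH1 W)
  | 30 => types_G1_H1 W cmm pgg /\ ~ strand_transitive (planarH1 W)
  | _ => False
  end.

Definition isonemal_of_species (n : nat) (W : prefabric) : Prop :=
  [/\ isonemal W, exists2 p, has_order W p & (4 < p)%N & roth_type n W].

(* A thick striping by colours in [C] is given by the colours [cw a] of the warp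
   pairs [2a, 2a+2] x R and [cf b] of the weft pairs R x [2b, 2b+2]. *)
Definition strand_colour (C : Type) (cw cf : int -> C) (s : strand) : C :=
  match s with
  | Warp i => cw (i %/ 2)%Z
  | Weft j => cf (j %/ 2)%Z
  end.

Definition colour_symmetry (C : Type) (col : strand -> C) (t : grid_isometry) :=
  forall x : C, exists y : C,
    forall s, col s = x -> col (act_strand t s) = y.

Definition perfect_colouring (W : prefabric) (C : Type) (col : strand -> C) :=
  forall t r, inG1 W t r -> colour_symmetry col t.

Definition redundant_block (C : eqType) (cw cf : int -> C) (a b : int) : bool :=
  cw a == cf b.

Definition is_twill (c : nat) (D : int -> int -> bool) : Prop :=
  exists t : grid_isometry, forall i j : int,
    D i j = (let: (i', j') := act_cell t (i, j) in (c%:Z %| i' - j')%Z).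

Definition double (D : int -> int -> bool) (i j : int) : bool :=
  D (i %/ 2)%Z (j %/ 2)%Z.

(* The cells lying in redundant blocks are the dark cells of a doubled
   (c-1)/1 twill. *)
Definition redundancy_doubled_twill
    (C : eqType) (cw cf : int -> C) (c : nat) : Prop :=
  exists2 D, is_twill c D &
    forall i j : int,
      redundant_block cw cf (i %/ 2)%Z (j %/ 2)%Z = double D i j.

(* Main.v *)
Require Import Defs.
From mathcomp Require Import all_boot all_order all_algebra.
From mathcomp Require Import zify ring.
Set Implicit Arguments.
Unset Strict Implicit.
Unset Printing Implicit Defensive.
Import Order.TTheory GRing.Theory Num.Theory.
Local Open Scope ring_scope.

(** Colour warp pair a and weft pair a by a mod c, where c = 2m+1.  The isometries
    that permute the colours are the translations, half-turns and diagonal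
    reflections or glides whose shifts u, v are even and congruent mod 2c.  In each
    species we fix such a group, in which some multiple C of c plays the role of c,
    and build the design from one periodic word w on warp 0: a translation (2, 2l)
    and a half-turn, with prescribed signs, carry w to all other warps.  A reflection
    or glide in a diagonal is then a symmetry as soon as w has certain
    (anti)symmetries on the residue classes mod 4.  If moreover w is chiral and has
    no unwanted translations, the symmetry group contains nothing else, because a
    symmetry taking warps to warps is determined by its effect on w, and the others
    are obtained from these by composing with the reflection.  Chirality is forced by
    a short factor of w that occurs once in a period, up to complementation, and never
    reversed.  Taking C = c^4, which is 1 mod 16, makes everything checkable by
    computation uniformly in c. *)

(** * Powers of signs, written additively with [true] as complementation, and symmetries of
    designs *)

Definition sgn (s : bool) (a : int) : bool := s && ~~ (2 %| a)%Z.

Lemma sgn0 (s : bool) : sgn s 0 = false.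
Proof. by rewrite /sgn dvdz0 andbF. Qed.

Lemma sgnD (s : bool) (a b : int) : sgn s (a + b) = sgn s a (+) sgn s b.
Proof. by rewrite /sgn; case: s => //=; lia. Qed.

Lemma sgnN (s : bool) (a : int) : sgn s (- a) = sgn s a.
Proof. by rewrite /sgn; case: s => //=; lia. Qed.

Lemma sgn_double (s : bool) (a : int) : sgn s (2 * a) = false.
Proof. by rewrite /sgn; case: s => //=; lia. Qed.

Lemma sgnS (s : bool) (a : int) : sgn s (a + 1) = s (+) sgn s a.
Proof. by rewrite sgnD addbC /sgn; case: s. Qed.

Lemma evenVodd (i : int) : (exists a, i = 2 * a) \/ (exists a, i = 2 * a + 1).
Proof.
by have [h|h] := boolP (2 %| i)%Z; [left|right]; exists (i %/ 2)%Z; lia.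
Qed.

Ltac addb_case x :=
  lazymatch x with
  | true => fail
  | false => fail
  | addb _ _ => fail
  | _ => case: {+}x
  end.

Ltac addb_solve :=
  repeat match goal with
  | |- context [addb ?x _] => addb_case x
  | |- context [addb _ ?x] => addb_case x
  end; by [].

Definition design_symmetry (W : prefabric) (t : grid_isometry) (s : bool) :=
  forall i j, W (act_cell t (i, j)).1 (act_cell t (i, j)).2 = s (+) W i j.

(** Exchanging warps and wefts reverses the meaning of dark, so [swap] contributes one more
    complementation besides [r]. *)
Lemma inG1P (W : prefabric) (t : grid_isometry) (r : bool) :
  inG1 W t r <-> design_symmetry W t (r (+) swap t).
Proof.
split=> [H i j|H [i|j] [i'|j']].
- have := H (Warp i) (Weft j).
  rewrite /= /act_cell; case: (swap t) => /= ->; case: r {H} => //=;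
    by rewrite ?negbK ?addbF.
- by case: r {H} => /=; case: (swap t).
- have := H i j'.
  by rewrite /= /act_cell; case: (swap t); case: r {H} => /= ->;
    case: (W i j').
- have := H i' j.
  by rewrite /= /act_cell; case: (swap t); case: r {H} => /= ->;
    case: (W i' j).
- by case: r {H} => /=; case: (swap t).
Qed.

(** With an even shift, [act_index] keeps the parity of a strand index without negation and changes
    it with negation, so any index reaches any other. *)
Lemma strand_transitive_shifts (Gam : grid_isometry -> Prop) :
  (forall s n y, exists2 t, Gam t &
     [/\ swap t = s, negx t = n, negy t = n & shiftx t = 2 * y]) ->
  (forall s n y, exists2 t, Gam t &
     [/\ swap t = s, negx t = n, negy t = n & shifty t = 2 * y]) ->
  strand_transitive Gam.
Proof.
move=> hx hy.
have ex (i i' : int) : exists n y, act_index n (2 * y) i = i'.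
  have [[y yE]|[y yE]] := evenVodd (i' - i).
    by exists false, y; rewrite /act_index; lia.
  by exists true, (i + y + 1); rewrite /act_index; lia.
case=> i [] i'; have [n [y yE]] := ex i i'.
- by have [t tG [sE nE _ xE]] := hx false n y; exists t; rewrite /= sE nE xE yE.
- by have [t tG [sE _ nE xE]] := hy true n y; exists t; rewrite /= sE nE xE yE.
- by have [t tG [sE nE _ xE]] := hx true n y; exists t; rewrite /= sE nE xE yE.
- by have [t tG [sE _ nE xE]] := hy false n y; exists t; rewrite /= sE nE xE yE.
Qed.

(** * Colouring the strand pairs by residues modulo c *)

Section Colours.

Variable m : nat.
Local Notation c := (2 * m + 1)%N.

Lemma residue_subproof (a : int) : (`|(a %% c)%Z| < c)%N.
Proof. by have := @ltz_mod a c; have := @modz_ge0 a c; lia. Qed.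

Definition residue (a : int) : 'I_c := Ordinal (residue_subproof a).

Lemma residueP (a b : int) : (residue a == residue b) = (c %| a - b)%Z.
Proof.
rewrite -eqz_mod_dvd -val_eqE /=.
by have := @modz_ge0 a c; have := @modz_ge0 b c; lia.
Qed.

Lemma residue_surj (x : 'I_c) : exists a, residue a = x.
Proof.
exists (val x)%:Z; apply: val_inj; rewrite /= modz_small //.
by have := ltn_ord x; lia.
Qed.

Lemma residue_doubled_twill : redundancy_doubled_twill residue residue c.
Proof.
exists (fun i j => residue i == residue j) => //.
by exists (translation 0 0) => i j; rewrite /act_cell /act_index /= !add0r residueP.
Qed.

(** Even shifts move whole strand pairs, by [a] on one axis and [b] on the other. These agree modulo
    c, so strands of one colour land on one colour, whether they are warps or wefts. *)
Lemma colour_symmetry_residue (t : grid_isometry) (a b : int) :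
  negx t = negy t -> shiftx t = 2 * a -> shifty t = 2 * b -> (c %| a - b)%Z ->
  colour_symmetry (strand_colour residue residue) t.
Proof.
move=> nE xE yE cab x; have [x0 <-] := residue_surj x.
exists (residue (act_index (negx t) a x0)).
have half n y i : (act_index n (2 * y) i %/ 2)%Z = act_index n y (i %/ 2)%Z.
  by rewrite /act_index; case: n; lia.
have same n y z i : (c %| y - z)%Z -> residue i = residue x0 ->
    residue (act_index n y i) = residue (act_index n z x0).
  move=> cyz /eqP; rewrite residueP => ci; apply/eqP; rewrite residueP.
  rewrite /act_index; case: n.
    have -> : y - i - 1 - (z - x0 - 1) = (y - z) - (i - x0) by ring.
    exact: rpredB.
  have -> : y + i - (z + x0) = (y - z) + (i - x0) by ring.
  exact: rpredD.
have cba : (c %| b - a)%Z by rewrite -opprB rpredN.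
have caa : (c %| a - a)%Z by rewrite subrr dvdz0.
by case=> i /= /same h; case: (swap t) => /=; rewrite -?nE ?xE ?yE half; apply: h.
Qed.

End Colours.

(** * The design built from one word, and its symmetry group *)

Section Weave.

Variables (w : int -> bool) (sT sH sR sV : bool) (l kap q p : int).

(* The design determined by warp 0: the translation (2, 2 l) multiplies it by
   the sign [sT] and the half-turn about (0, kap / 2) by [sH]. *)
Definition weave : prefabric := fun i j =>
  let a := (i %/ 2)%Z in
  if (2 %| i)%Z then sgn sT a (+) w (j - 2 * l * a)
  else sH (+) sgn sT (a + 1) (+) w (kap - 1 - j + 2 * l * (a + 1)).

Lemma weave_even (a j : int) :
  weave (2 * a) j = sgn sT a (+) w (j - 2 * l * a).
Proof.
rewrite /weave; have -> : (2 %| 2 * a)%Z by lia.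
by have -> : (2 * a %/ 2)%Z = a by lia.
Qed.

Lemma weave_odd (a j : int) :
  weave (2 * a + 1) j =
  sH (+) sgn sT (a + 1) (+) w (kap - 1 - j + 2 * l * (a + 1)).
Proof.
rewrite /weave; have -> : (2 %| 2 * a + 1)%Z = false by lia.
by have -> : ((2 * a + 1) %/ 2)%Z = a by lia.
Qed.

(** Let T and V be the translations (2, 2 l) and (0, p), H the half-turn about (0, kap / 2), and R
    the map (x, y) -> (y, x + q). The shift is that of T^a V^b composed with H if [negx] holds and R
    if [swap] holds; R is applied before H, which turns q into - q. *)
Definition vertical_shift (t : grid_isometry) (a b : int) : int :=
  2 * l * a + p * b + (if negx t then kap else 0)
  + (if swap t then (if negx t then - q else q) else 0).

Definition sign_of (t : grid_isometry) (a b : int) : bool :=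
  sgn sT a (+) sgn sV b (+) (sH && negx t) (+) (sR && swap t).

Definition weave_group (t : grid_isometry) (s : bool) : Prop :=
  exists a b, [/\ negx t = negy t, shiftx t = 2 * a,
    shifty t = vertical_shift t a b & s = sign_of t a b].

Variables (l2 k2 q2 p2 e f : int).
Hypotheses (l_odd : l = 2 * l2 + 1) (kap_even : kap = 2 * k2)
  (q_even : q = 2 * q2) (p_even : p = 2 * p2) (p_gt4 : 4 < p).
Hypothesis w_period : forall j : int, w (j + p) = sV (+) w j.
(** Consistency of the group: R conjugates T into T^l V^(-e) and H into T^k2 V^(-f) H. The sign
    conditions say that both sides of these relations carry the same sign. *)
Hypotheses (l_sqr : 2 * (l * l - 1) = p * e) (sgn_e : sgn sV e = false).
Hypotheses (kap_q : kap * (1 + l) - 2 * q = p * f)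
  (sgn_f : sgn sV f = sgn sT k2).
(** [w_even] and [w_odd] say that R is a symmetry with sign [sR] on the even and on the odd cells of
    warp 0. *)
Hypothesis w_even : forall a : int,
  sgn sT a (+) w (q - 2 * l * a) = sR (+) w (2 * a).
Hypothesis w_odd : forall a : int,
  sH (+) sgn sT (a + 1) (+) w (kap - 1 - q + 2 * l * (a + 1)) =
  sR (+) w (2 * a + 1).
Hypothesis w_shift : forall (k : int) s,
  (forall j : int, w (j + k) = s (+) w j) -> (p %| k)%Z.
Hypothesis w_chiral : forall (k : int) s,
  ~ (forall j : int, w (k - j) = s (+) w j).

Lemma sgn_l s a : sgn s (l * a) = sgn s a.
Proof. by rewrite l_odd mulrDl mul1r -mulrA sgnD sgn_double. Qed.

Lemma sgn_eM a : sgn sV (e * a) = false.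
Proof.
have := sgn_e; rewrite /sgn; case: sV => //= /negbFE he.
by rewrite dvdz_mulr.
Qed.

Lemma w_periods j b : w (j + p * b) = sgn sV b (+) w j.
Proof.
have pos (n : nat) i : w (i + p * n%:Z) = sgn sV n (+) w i.
  elim: n => [|n IH]; first by rewrite mulr0 addr0 sgn0.
  have -> : i + p * n.+1 = i + p * n%:Z + p by rewrite intS; ring.
  by rewrite w_period IH addbA intS addrC sgnS.
case: (intP b) => [|n|n]; first by rewrite mulr0 addr0 sgn0.
  exact: pos.
rewrite sgnN -[j in RHS](subrK (p * n.+1%:Z)) pos addbA addbb mulrN.
by rewrite addFb.
Qed.

Lemma w_l_sqr j a : w (j + 2 * l * (l * a)) = w (j + 2 * a).
Proof.
have -> : j + 2 * l * (l * a) = j + 2 * a + p * (e * a).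
  by rewrite [p * _]mulrA -l_sqr; ring.
by rewrite w_periods sgn_eM.
Qed.

Lemma w_kap_q j : w (j + (kap * (1 + l) - 2 * q)) = sgn sT k2 (+) w j.
Proof. by rewrite kap_q w_periods sgn_f. Qed.

(** Each cell is brought back to warp 0, where [w_even] or [w_odd] applies according to the parity
    of i + j. The remaining discrepancies in position are absorbed by the conjugation relations, in
    the form of [w_l_sqr] and [w_kap_q]. *)
Lemma weave_swap i j : weave j (q + i) = sR (+) weave i j.
Proof.
have [[a ->]|[a ->]] := evenVodd i; have [[b ->]|[b ->]] := evenVodd j.
- rewrite !weave_even addbCA.
  have -> : 2 * b - 2 * l * a = 2 * (b - l * a) by ring.
  rewrite -w_even.
  have -> : q - 2 * l * (b - l * a) = q - 2 * l * b + 2 * l * (l * a) by ring.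
  rewrite w_l_sqr sgnD sgnN sgn_l.
  have -> : q - 2 * l * b + 2 * a = q + 2 * a - 2 * l * b by ring.
  addb_solve.
- rewrite weave_odd weave_even addbCA.
  have -> : 2 * b + 1 - 2 * l * a = 2 * (b - l * a) + 1 by ring.
  rewrite -w_odd.
  have -> : kap - 1 - q + 2 * l * (b - l * a + 1) =
    kap - 1 - q + 2 * l * (b + 1) + 2 * l * (l * (- a)) by ring.
  rewrite w_l_sqr.
  have -> : kap - 1 - q + 2 * l * (b + 1) + 2 * - a =
    kap - 1 - (q + 2 * a) + 2 * l * (b + 1) by ring.
  have -> : b - l * a + 1 = b + 1 + - (l * a) by ring.
  rewrite [sgn _ (_ + - _)]sgnD sgnN sgn_l.
  addb_solve.
- rewrite weave_odd weave_even.
  have E : kap - 1 - 2 * b + 2 * l * (a + 1) =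
    2 * (k2 - 1 - b + l * (a + 1)) + 1 by rewrite kap_even; ring.
  rewrite E; have := w_odd (k2 - 1 - b + l * (a + 1)).
  have -> : kap - 1 - q + 2 * l * (k2 - 1 - b + l * (a + 1) + 1) =
    kap - 1 - q + l * kap - 2 * l * b + 2 * l * (l * (a + 1)).
    by rewrite kap_even; ring.
  rewrite w_l_sqr.
  have -> : kap - 1 - q + l * kap - 2 * l * b + 2 * (a + 1) =
     q + (2 * a + 1) - 2 * l * b + (kap * (1 + l) - 2 * q) by ring.
  rewrite w_kap_q.
  have -> : k2 - 1 - b + l * (a + 1) + 1 = k2 - b + l * (a + 1) by ring.
  rewrite !sgnD sgn_l sgnN !sgnD => /eqP; apply: contraTeq; addb_solve.
- rewrite !weave_odd.
  have E : kap - 1 - (2 * b + 1) + 2 * l * (a + 1) =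
    2 * (k2 - 1 - b + l * (a + 1)) by rewrite kap_even; ring.
  rewrite E; have := w_even (k2 - 1 - b + l * (a + 1)).
  have -> : q - 2 * l * (k2 - 1 - b + l * (a + 1)) =
    q - l * kap + 2 * l * (b + 1) + 2 * l * (l * (- (a + 1))).
    by rewrite kap_even; ring.
  rewrite w_l_sqr.
  have -> : kap - 1 - (q + (2 * a + 1)) + 2 * l * (b + 1) =
    q - l * kap + 2 * l * (b + 1) + 2 * - (a + 1) + (kap * (1 + l) - 2 * q).
    by ring.
  rewrite w_kap_q.
  have -> : k2 - 1 - b + l * (a + 1) = k2 - (b + 1) + l * (a + 1) by ring.
  rewrite !sgnD sgn_l sgnN !sgnD => /eqP; apply: contraTeq; addb_solve.
Qed.

(** Modulo p one has 2 l^2 = 2, so if p divided 2 l it would divide 2, against p > 4. *)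
Lemma not_dvdz_2l : ~~ (p %| 2 * l)%Z.
Proof.
apply/negP=> /dvdzP[z hz].
have /dvdzP[y hy] : (p %| 2)%Z.
  apply/dvdzP; exists (z * l - e); rewrite mulrBl [e * p]mulrC -l_sqr.
  have -> : z * l * p = z * p * l by ring.
  by rewrite -hz; ring.
have y0 : y != 0 by apply: contra_eq_neq hy => ->; rewrite mul0r.
have : p <= `|y| * p by rewrite ler_peMl; lia.
have <- : `|y * p| = `|y| * p by rewrite normrM [`|p|]ger0_norm //; lia.
by rewrite -hy; lia.
Qed.

(** The image of warp 0 again shows w, shifted or reversed. Chirality determines [ny] from the
    parity of the image warp, and [w_shift] determines the shift modulo p. A wrong [nx] is excluded
    by looking at warp 1. *)
Lemma weave_rigid nx ny u v s :
  design_symmetry weave (GridIsometry false nx ny u v) s ->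
  weave_group (GridIsometry false nx ny u v) s.
Proof.
move=> H.
have H0 j : weave (act_index nx u 0) (act_index ny v j) = s (+) w j.
  rewrite -[w j](_ : weave (2 * 0) j = _).
    by rewrite -H /act_cell /= !mulr0.
  by rewrite weave_even mulr0 subr0 sgn0.
have H1 j : weave (act_index nx u 1) (act_index ny v j) =
    s (+) (sH (+) sT (+) w (kap - 1 - j + 2 * l)).
  rewrite -[sH (+) _ (+) _](_ : weave (2 * 0 + 1) j = _).
    by rewrite -H /act_cell /= mulr0 add0r.
  by rewrite weave_odd sgnS sgn0 addbF add0r mulr1.
have swapb (b c d : bool) : b (+) c = d -> c = b (+) d by case: b; case: c; case: d.
have [[a ha]|[a ha]] := evenVodd (act_index nx u 0).
- have {}H0 j : w (act_index ny v j - 2 * l * a) = (sgn sT a (+) s) (+) w j.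
    by rewrite -addbA; apply: swapb; rewrite -H0 ha weave_even.
  case: ny H H0 H1 => H H0 H1.
    case: (@w_chiral (v - 1 - 2 * l * a) (sgn sT a (+) s)) => j.
    by rewrite -H0 /act_index; congr w; ring.
  have dv : (p %| v - 2 * l * a)%Z.
    by apply: (@w_shift _ (sgn sT a (+) s)) => j; rewrite -H0; congr w; rewrite /act_index; ring.
  case: nx H H0 H1 ha => H H0 H1 ha.
    (* Here [nx] and [ny] differ; the images of warps 0 and 1 together would make p divide 2 l. *)
    have ea : act_index true u 1 = 2 * (a - 1) + 1 by rewrite /act_index in ha *; lia.
    case/negP: not_dvdz_2l.
    have : (p %| 2 * l * a - v - 2 * l)%Z.
      apply: (@w_shift _ (sgn sT a (+) s (+) sT)) => j.
      have := H1 (kap - 1 - j + 2 * l); rewrite ea weave_odd /act_index.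
      have -> : kap - 1 - (kap - 1 - j + 2 * l) + 2 * l = j by ring.
      have -> : kap - 1 - (v + (kap - 1 - j + 2 * l)) + 2 * l * (a - 1 + 1) =
        j + (2 * l * a - v - 2 * l) by ring.
      by rewrite subrK => /eqP; apply: contraTeq; addb_solve.
    move=> d2; rewrite -rpredN.
    have -> : - (2 * l) = v - 2 * l * a + (2 * l * a - v - 2 * l) by ring.
    exact: rpredD.
  have /dvdzP[b hb] := dv.
  exists a, b; split=> //=; first by rewrite -ha /act_index addr0.
    by rewrite /vertical_shift /=; lia.
  have := H0 0; rewrite /sign_of /= !andbF !addbF /act_index addr0.
  have -> : v - 2 * l * a = 0 + p * b by lia.
  by rewrite w_periods => /eqP; apply: contraTeq; addb_solve.
- have {}H0 j : w (kap - 1 - act_index ny v j + 2 * l * (a + 1)) =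
      (sH (+) sgn sT (a + 1) (+) s) (+) w j.
    by rewrite -addbA; apply: swapb; rewrite -H0 ha weave_odd.
  case: ny H H0 H1 => H H0 H1; last first.
    case: (@w_chiral (kap - 1 - v + 2 * l * (a + 1)) (sH (+) sgn sT (a + 1) (+) s)) => j.
    by rewrite -H0 /act_index; congr w; ring.
  have dv : (p %| kap - v + 2 * l * (a + 1))%Z.
    apply: (@w_shift _ (sH (+) sgn sT (a + 1) (+) s)) => j; rewrite -H0; congr w.
    by rewrite /act_index; ring.
  case: nx H H0 H1 ha => H H0 H1 ha; last first.
    have ea : act_index false u 1 = 2 * (a + 1) by rewrite /act_index in ha *; lia.
    case/negP: not_dvdz_2l.
    have : (p %| v - kap - 2 * l * (a + 1) - 2 * l)%Z.
      apply: (@w_shift _ (sgn sT (a + 1) (+) s (+) sH (+) sT)) => j.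
      have := H1 (kap - 1 - j + 2 * l); rewrite ea weave_even /act_index.
      have -> : kap - 1 - (kap - 1 - j + 2 * l) + 2 * l = j by ring.
      have -> : v - (kap - 1 - j + 2 * l) - 1 - 2 * l * (a + 1) =
        j + (v - kap - 2 * l * (a + 1) - 2 * l) by ring.
      by move=> /eqP; apply: contraTeq; addb_solve.
    move=> d2; rewrite -rpredN.
    have -> : - (2 * l) = kap - v + 2 * l * (a + 1) +
      (v - kap - 2 * l * (a + 1) - 2 * l) by ring.
    exact: rpredD.
  have /dvdzP[b hb] := dv.
  (* The half-turn takes warp 0 to warp -1, so a + 1 translations are needed to reach warp 2 a + 1;
     v enters [hb] negatively, whence - b. *)
  exists (a + 1), (- b); split=> //=; first by rewrite /act_index in ha; lia.
    by rewrite /vertical_shift /=; lia.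
  have := H0 0; rewrite /sign_of /= !andbF !addbF /act_index subr0 andbT sgnN.
  have -> : kap - 1 - (v - 1) + 2 * l * (a + 1) = 0 + p * b.
    by lia.
  by rewrite w_periods => /eqP; apply: contraTeq; addb_solve.
Qed.

Lemma weave_nonswap n a b :
  design_symmetry weave
    (GridIsometry false n n (2 * a) (2 * l * a + p * b + (if n then kap else 0)))
    (sgn sT a (+) sgn sV b (+) (sH && n)).
Proof.
move=> i j; rewrite /act_cell /act_index /=; case: n.
- have [[c ->]|[c ->]] := evenVodd i.
    have -> : 2 * a - 2 * c - 1 = 2 * (a - c - 1) + 1 by ring.
    rewrite weave_odd weave_even subrK.
    have -> : kap - 1 - (2 * l * a + p * b + kap - j - 1) + 2 * l * (a - c) =
      j - 2 * l * c + p * (- b) by ring.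
    rewrite w_periods sgnN sgnD sgnN andbT.
    addb_solve.
  have -> : 2 * a - (2 * c + 1) - 1 = 2 * (a - (c + 1)) by ring.
  rewrite weave_odd weave_even.
  have -> : 2 * l * a + p * b + kap - j - 1 - 2 * l * (a - (c + 1)) =
    kap - 1 - j + 2 * l * (c + 1) + p * b by ring.
  rewrite w_periods [sgn _ (a - _)]sgnD sgnN andbT.
  addb_solve.
- rewrite addr0 andbF addbF.
  have [[c ->]|[c ->]] := evenVodd i.
    rewrite -mulrDr !weave_even.
    have -> : 2 * l * a + p * b + j - 2 * l * (a + c) = j - 2 * l * c + p * b by ring.
    rewrite w_periods sgnD; addb_solve.
  rewrite addrA -mulrDr !weave_odd -[a + c + 1]addrA.
  have -> : kap - 1 - (2 * l * a + p * b + j) + 2 * l * (a + (c + 1)) =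
    kap - 1 - j + 2 * l * (c + 1) + p * (- b) by ring.
  rewrite w_periods sgnN [sgn _ (a + _)]sgnD; addb_solve.
Qed.

(* Composing with the reflection (i, j) |-> (j, q + i) reduces everything to the
   symmetries that map warps to warps. *)
Lemma weave_groupP t s : design_symmetry weave t s <-> weave_group t s.
Proof.
case: t => -[] nx ny u v.
- have iE (k : int) : act_index ny v k = act_index ny (v + (-1) ^+ (~~ ny) * q) (q + k).
    by rewrite /act_index; case: ny; rewrite /= ?expr1 ?expr0; ring.
  have step : design_symmetry weave (GridIsometry true nx ny u v) s <->
      design_symmetry weave
        (GridIsometry false nx ny u (v + (-1) ^+ (~~ ny) * q)) (s (+) sR).
    split=> H i j; rewrite /act_cell /=.
      have := H (j - q) i; rewrite /act_cell /= iE subrKC => ->.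
      have -> : weave i j = sR (+) weave (j - q) i.
        by rewrite -weave_swap subrKC.
      addb_solve.
    have := H j (q + i); rewrite /act_cell /= -iE => ->.
    by rewrite weave_swap; addb_solve.
  split=> [/step/weave_rigid[a [b [/= nE uE vE sE]]]|[a [b [/= nE uE vE sE]]]].
    exists a, b; split=> //=.
      rewrite /vertical_shift /= in vE *.
      by move: vE; rewrite -nE; case: nx {nE sE step uE} => /=; rewrite ?expr0 ?expr1; lia.
    move: sE; rewrite /sign_of /= andbF addbF andbT => <-.
    by rewrite addbK.
  apply/step; rewrite -nE.
  have -> : v + (-1) ^+ (~~ nx) * q = 2 * l * a + p * b + (if nx then kap else 0).
    by rewrite vE /vertical_shift /=; case: nx {nE vE sE step uE}; rewrite /= ?expr0 ?expr1; ring.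
  rewrite uE sE /sign_of /= andbT addbK.
  exact: weave_nonswap.
- split=> [/weave_rigid //|[a [b [/= nE -> -> ->]]]].
  rewrite /vertical_shift /sign_of /= andbF addbF addr0 -nE.
  exact: weave_nonswap.
Qed.


Lemma planarG1P t : planarG1 weave t <-> exists s, weave_group t s.
Proof.
split=> [[r /inG1P/weave_groupP h]|[s /weave_groupP h]].
  by exists (r (+) swap t).
by exists (s (+) swap t); apply/inG1P; rewrite addbK.
Qed.

Lemma planarH1P t : planarH1 weave t <-> weave_group t (swap t).
Proof. by rewrite -weave_groupP; apply: inG1P. Qed.

Lemma vertical_shift_even t a b :
  vertical_shift t a b = 2 * (l * a + p2 * b + (if negx t then k2 else 0)
    + (if swap t then (if negx t then - q2 else q2) else 0)).
Proof.
rewrite /vertical_shift p_even kap_even q_even.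
by case: (negx t); case: (swap t); ring.
Qed.

Lemma weave_groupI sw n a b :
  weave_group
    (GridIsometry sw n n (2 * a) (vertical_shift (GridIsometry sw n n 0 0) a b))
    (sign_of (GridIsometry sw n n 0 0) a b).
Proof. by exists a, b. Qed.

(** By [l_sqr], T^l V^(-e) is the translation (2 l, 2), so its powers realise every even vertical
    displacement. *)
Lemma vertical_shift_onto t y : exists a b, vertical_shift t a b = 2 * y.
Proof.
pose z := y - (if negx t then k2 else 0)
  - (if swap t then (if negx t then - q2 else q2) else 0).
exists (l * z), (- (e * z)).
rewrite -[2 * y]/(2 * (y : int)) /vertical_shift mulrN mulrA [p * (e * z)]mulrA -l_sqr.
rewrite /z kap_even q_even.
by case: (negx t); case: (swap t); ring.
Qed.

Lemma weave_transitive : strand_transitive (planarG1 weave).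
Proof.
apply: strand_transitive_shifts => s n y.
  exists (GridIsometry s n n (2 * y) (vertical_shift (GridIsometry s n n 0 0) y 0)) => //.
  by apply/planarG1P; eexists; apply: weave_groupI.
have [a [b ab]] := vertical_shift_onto (GridIsometry s n n 0 0) y.
exists (GridIsometry s n n (2 * a) (2 * y)) => //.
by apply/planarG1P; eexists; rewrite -ab; apply: weave_groupI.
Qed.

Lemma weave_isonemal : isonemal weave.
Proof.
split; last exact: weave_transitive.
exists 2, (2 * l), 0, p; split; first by lia.
- apply/planarG1P; exists (sign_of (translation 2 (2 * l)) 1 0), 1, 0.
  by split=> //=; rewrite /vertical_shift /=; ring.
- apply/planarG1P; exists (sign_of (translation 0 p) 0 1), 0, 1.
  by split=> //=; rewrite /vertical_shift /=; ring.
Qed.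

(** All shifts in the group are even, so a half-turn changes the parity of every strand index. *)
Lemma weave_no_half_turn_on_strand : no_half_turn_on_strand weave.
Proof.
move=> t s /planarG1P[r [a [b [_ xE + _]]]] /and3P[/negPf sE nx ny].
rewrite vertical_shift_even; move: (_ + _) => y yE.
by case: s => i /=; rewrite sE ?nx ?ny ?xE ?yE /act_index => -[]; lia.
Qed.

Lemma weave_perfect (m : nat) :
  ((2 * m + 1)%N %| p2)%Z -> ((2 * m + 1)%N %| k2)%Z ->
  ((2 * m + 1)%N %| q2)%Z -> ((2 * m + 1)%N %| l - 1)%Z ->
  perfect_colouring weave (strand_colour (@residue m) (@residue m)).
Proof.
move=> cp ck cq cl t r /inG1P/weave_groupP[a [b [nE xE yE _]]].
rewrite vertical_shift_even in yE.
apply: (colour_symmetry_residue nE xE yE).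
set K := if negx t then k2 else 0; set Q := if swap t then _ else _.
have -> : a - (l * a + p2 * b + K + Q) =
  - ((l - 1) * a) - p2 * b - K - Q by ring.
rewrite !rpredB ?rpredN ?dvdz_mulr // /K /Q.
  by case: (negx t); rewrite ?dvdz0.
by case: (swap t); case: (negx t); rewrite ?rpredN ?dvdz0.
Qed.

Lemma along_weave s : exists c (d : bool) h,
  forall k, along weave s k = c (+) w (if d then h - k else h + k).
Proof.
have warp i : exists c (d : bool) h,
    forall k, weave i k = c (+) w (if d then h - k else h + k).
  have [[a ->]|[a ->]] := evenVodd i.
    exists (sgn sT a), false, (- (2 * l * a)) => k.
    by rewrite weave_even addrC.
  exists (sH (+) sgn sT (a + 1)), true, (kap - 1 + 2 * l * (a + 1)) => k.
  by rewrite weave_odd; congr (_ (+) w _); ring.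
case: s => [i|j]; first exact: warp.
have [c [d [h hw]]] := warp (j - q).
exists (sR (+) c), d, h => k; rewrite /= -addbA -hw -weave_swap.
by congr weave; ring.
Qed.

(** Every strand carries w up to shift, reversal and complementation. The least period is p, or 2 p
    when V complements. *)
Lemma weave_order : exists2 n, has_order weave n & (4 < n)%N.
Proof.
pose P : int := if sV then 2 * p else p.
have wP j : w (j + P) = w j.
  rewrite /P; have := w_periods j 2; have := w_period j.
  by case: sV => //= _; rewrite mulrC.
exists `|P|%N; last by rewrite /P; case: sV; lia.
move=> s; have [c [d [h hs]]] := along_weave s.
have [PE P0] : `|P|%N%:Z = P /\ 0 < P by rewrite /P; case: sV; lia.
split=> [|n [n0 hn]].
  split=> [|k]; first by lia.
  rewrite !hs PE; congr (_ (+) _); case: d {hs}; last by rewrite addrA wP.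
  by rewrite -[LHS]wP opprD addrA subrK.
have hw j : w (j + n%:Z) = w j.
  case: d hs => hs.
    have := hn (h - j - n%:Z); rewrite !hs => /addbI.
    have -> : h - (h - j - n%:Z + n%:Z) = j by ring.
    by have -> : h - (h - j - n%:Z) = j + n%:Z by ring.
  have := hn (j - h); rewrite !hs => /addbI.
  have -> : h + (j - h + n%:Z) = j + n%:Z by ring.
  by have -> : h + (j - h) = j by ring.
have /dvdzP[b nb] : (p %| n%:Z)%Z by apply: (@w_shift _ false).
have : sgn sV b = false.
  have := hw 0; rewrite nb mulrC w_periods.
  by case: (sgn _ _) => //; case: (w 0).
rewrite /P /sgn; case: sV => /= hb.
  have [c' bE] : exists c', b = 2 * c' by exists (b %/ 2)%Z; lia.
  have : 0 < c' by nia.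
  by nia.
have : 0 < b by nia.
by nia.
Qed.

(** * The fabric property, and transitivity of H1 *)

Definition incomparable (K : int) (s : bool) : Prop :=
  (exists2 j, w j = false & s (+) w (K - j) = true) /\
  (exists2 j, w j = true & s (+) w (K - j) = false).

Hypotheses (incomp_next : incomparable (kap - 1 + 2 * l) (sH (+) sT))
  (incomp_prev : incomparable (kap - 1) sH).

(** [incomp_next] and [incomp_prev] compare warp 0 with warps 1 and -1; powers of T carry this to
    all neighbouring warps. *)
Lemma weave_neighbours i :
  (exists2 j, weave i j = false & weave (i + 1) j = true) /\
  (exists2 j, weave i j = true & weave (i + 1) j = false).
Proof.
have shift (u v : int -> bool) c h :
    (exists2 j, u j = false & v j = true) /\ (exists2 j, u j = true & v j = false) ->
    (forall j, weave i (j + h) = c (+) u j) ->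
    (forall j, weave (i + 1) (j + h) = c (+) v j) ->
    (exists2 j, weave i j = false & weave (i + 1) j = true) /\
    (exists2 j, weave i j = true & weave (i + 1) j = false).
  case=> -[j j1 j2] [k k1 k2'] hu hv.
  case: c hu hv => hu hv; split; [exists (k + h)|exists (j + h)|exists (j + h)|exists (k + h)];
    by rewrite ?hu ?hv ?j1 ?j2 ?k1 ?k2'.
have [[a aE]|[a aE]] := evenVodd i.
- apply: (shift _ _ (sgn sT a) (2 * l * a) incomp_next) => j; rewrite aE.
    by rewrite weave_even addrK.
  rewrite weave_odd sgnS.
  have -> : kap - 1 - (j + 2 * l * a) + 2 * l * (a + 1) = kap - 1 + 2 * l - j by ring.
  addb_solve.
- have {}aE' : i + 1 = 2 * (a + 1) by rewrite aE; ring.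
  case: incomp_prev => p1 p2'.
  apply: (shift (fun j => sH (+) w (kap - 1 - j)) w (sgn sT (a + 1)) (2 * l * (a + 1))).
  + case: p1 p2' => [j j1 j2] [k k1 k2']; split; [exists k|exists j] => //.
  + move=> j; rewrite aE weave_odd.
    have -> : kap - 1 - (j + 2 * l * (a + 1)) + 2 * l * (a + 1) = kap - 1 - j by ring.
    addb_solve.
  + by move=> j; rewrite aE' weave_even addrK.
Qed.

(** A set that lifts off contains every strand lying over one of its members. Passing from a warp to
    a weft over it, and from there to a neighbouring warp over that weft, reaches all warps and
    finally all wefts. Membership in [S] need not be decidable, hence the double negations. *)
Lemma weave_fabric : fabric weave.
Proof.
case=> S [[s1 Ss1] [s0 nSs0] Sup].
have up s s' : ~ ~ S s -> Defs.over weave s' s -> ~ ~ S s'.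
  by move=> nnS ov nS'; apply: nnS => /Sup/(_ nS'); rewrite ov.
have warp2 i i' j : weave i j = false -> weave i' j = true ->
    ~ ~ S (Warp i) -> ~ ~ S (Warp i').
  move=> h h' Si; apply: (up (Weft j)); last by rewrite /= h'.
  by apply: (up (Warp i)); rewrite //= h.
have incr i : ~ ~ S (Warp i) -> ~ ~ S (Warp (i + 1)).
  by case: (weave_neighbours i) => -[j h h'] _; apply: warp2 h h'.
have decr i : ~ ~ S (Warp (i + 1)) -> ~ ~ S (Warp i).
  by case: (weave_neighbours i) => _ [j h h']; apply: warp2 h' h.
have incrn (n : nat) i : ~ ~ S (Warp i) -> ~ ~ S (Warp (i + n%:Z)).
  elim: n => [|n IH] Si; first by rewrite addr0.
  by rewrite -addn1 PoszD addrA; apply/incr/IH.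
have decrn (n : nat) i : ~ ~ S (Warp i) -> ~ ~ S (Warp (i - n%:Z)).
  elim: n => [|n IH] Si; first by rewrite subr0.
  by apply: decr; rewrite -addn1 PoszD opprD addrA subrK; apply: IH.
have warps i i' : ~ ~ S (Warp i) -> ~ ~ S (Warp i').
  move=> Si; have [h|h] := lerP i i'.
    by have := incrn `|i' - i|%N i Si; rewrite (_ : i + _ = i') //; lia.
  by have := decrn `|i' - i|%N i Si; rewrite (_ : i - _ = i') //; lia.
have weft j b : exists i, weave i j = b.
  case: (weave_neighbours (j - q)) => -[k h _] [k' h' _].
  have E x : weave x j = sR (+) weave (j - q) x.
    by rewrite -weave_swap; congr weave; ring.
  by case: b; case sRE: sR; [exists k|exists k'|exists k'|exists k]; rewrite E sRE ?h ?h'.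
have all s : ~ ~ S s.
  have Sw : exists i, ~ ~ S (Warp i).
    case: s1 Ss1 => [i|j] Si; first by exists i.
    have [i ij] := weft j true; exists i.
    by apply: (up (Weft j)); [|rewrite /= ij].
  case: Sw => i0 Si0; case: s => [i|j]; first exact: warps Si0.
  have [i ij] := weft j false.
  by apply: (up (Warp i)); [exact: warps Si0|rewrite /= ij].
exact: all nSs0.
Qed.

(** A symmetry with the wrong sign is corrected by a sign-reversing translation that does not affect
    the prescribed shift: V when [shiftx] is prescribed, a horizontal one when [shifty] is. *)
Lemma weave_H1_transitive : sV -> sgn sT p2 = false ->
  strand_transitive (planarH1 weave).
Proof.
have sgnV1 : sV -> sgn sV 1 by rewrite /sgn => ->.
move=> /sgnV1 {}sgnV1 sTp; apply: strand_transitive_shifts => sw n y.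
  pose t b := GridIsometry sw n n (2 * y)
    (vertical_shift (GridIsometry sw n n 0 0) y b).
  case: (eqVneq (sign_of (GridIsometry sw n n 0 0) y 0) sw) => sE.
    by exists (t 0) => //; apply/planarH1P; exists y, 0.
  exists (t 1) => //; apply/planarH1P; exists y, 1; split=> //=.
  move: sE; rewrite /sign_of /= sgn0 sgnV1.
  by move: (sgn _ y) (sH && n) (sR && sw) => [] [] []; case: {+}sw.
have [a [b ab]] := vertical_shift_onto (GridIsometry sw n n 0 0) y.
case: (eqVneq (sign_of (GridIsometry sw n n 0 0) a b) sw) => [sE|sE].
  exists (GridIsometry sw n n (2 * a) (2 * y)) => //.
  by apply/planarH1P; exists a, b; split.
(* T^(- l p2) V^(1 + e p2) is horizontal by [l_sqr], and its sign is that of V because [sgn sT p2]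
   vanishes. *)
exists (GridIsometry sw n n (2 * (a - l * p2)) (2 * y)) => //.
apply/planarH1P; exists (a - l * p2), (b + 1 + e * p2); split=> //=.
  rewrite -ab /vertical_shift /=.
  have -> : 2 * l * (a - l * p2) + p * (b + 1 + e * p2) =
    2 * l * a + p * b + (p - 2 * (l * l) * p2 + p * e * p2) by ring.
  by rewrite -l_sqr p_even; congr (_ + _ + _); ring.
move: sE; rewrite /sign_of /= !sgnD sgnN sgn_l sTp sgn_eM sgnV1.
by move: (sgn _ a) (sgn _ b) (sH && n) (sR && sw) => [] [] [] []; case: {+}sw.
Qed.

(** Side-preserving elements without [swap] have a even, so they take warp 0 only to warps congruent
    to 0 or -1 modulo 4. *)
Lemma weave_H1_not_transitive : sT -> ~~ sV -> ~~ sH -> ~~ sR ->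
  ~ strand_transitive (planarH1 weave).
Proof.
move=> sT1 /negPf sV0 /negPf sH0 /negPf sR0 /(_ (Warp 0) (Warp 1)).
case=> t [/planarH1P[a [b [_ xE _]]]]; rewrite /sign_of sV0 sH0 sR0 /sgn sT1 /=.
by case: (swap t) => //= hs []; rewrite /act_index xE; case: (negx t); lia.
Qed.

Theorem weave_summary :
  [/\ [/\ fabric weave, isonemal weave,
          exists2 n, has_order weave n & (4 < n)%N
        & no_half_turn_on_strand weave],
      forall t, planarG1 weave t <-> exists s, weave_group t s,
      forall t, planarH1 weave t <-> weave_group t (swap t),
      (sV -> sgn sT p2 = false -> strand_transitive (planarH1 weave)) /\
      (sT -> ~~ sV -> ~~ sH -> ~~ sR -> ~ strand_transitive (planarH1 weave))
    & forall m : nat,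
        ((2 * m + 1)%N %| p2)%Z -> ((2 * m + 1)%N %| k2)%Z ->
        ((2 * m + 1)%N %| q2)%Z -> ((2 * m + 1)%N %| l - 1)%Z ->
        perfect_colouring weave (strand_colour (@residue m) (@residue m))].
Proof.
split; [split|exact: planarG1P|exact: planarH1P|split|].
- exact: weave_fabric.
- exact: weave_isonemal.
- exact: weave_order.
- exact: weave_no_half_turn_on_strand.
- exact: weave_H1_transitive.
- exact: weave_H1_not_transitive.
- exact: weave_perfect.
Qed.

End Weave.

(** * Recognising plane groups in adapted coordinates *)

Lemma of_crystallographic_type_iff (Gam Gam' : grid_isometry -> Prop) T :
  (forall t, Gam t <-> Gam' t) ->
  of_crystallographic_type Gam' T -> of_crystallographic_type Gam T.
Proof.
move=> GE [phi [aff [h1 h2]]]; exists phi; split=> //; split=> [t /GE/h1 //|f].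
by case/h2 => t /GE; exists t.
Qed.

(** All elements of pgg, pmg, pmm and cmm have this form, [s] marking those that reverse
    orientation; [half_type] records which half-integral shifts occur. *)
Definition half_map (n s : bool) (x y : int) (P : point) : point :=
  ((-1) ^+ (n (+) s) * P.1 + x%:~R / 2, (-1) ^+ n * P.2 + y%:~R / 2).

Definition half_type (T : plane_group) (s : bool) (x y : int) : bool :=
  let ox := ~~ (2 %| x)%Z in let oy := ~~ (2 %| y)%Z in
  match T with
  | pgg => (ox == s) && (oy == s)
  | pmg => (ox == s) && ~~ oy
  | pmm => ~~ ox && ~~ oy
  | cmm => ox == oy
  | _ => false
  end.

Lemma half_intE (x : int) : exists y : int,
  x%:~R / 2 = (if (2 %| x)%Z then 0 else 2^-1) + y%:~R :> rat.
Proof.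
have [[y ->]|[y ->]] := evenVodd x; exists y.
  have -> : (2 %| 2 * y)%Z by lia.
  by rewrite rmorphM /=; field.
have -> : (2 %| 2 * y + 1)%Z = false by lia.
by rewrite rmorphD rmorphM /=; field.
Qed.

Lemma half_map_in_group T n s x y :
  half_type T s x y -> in_plane_group T (half_map n s x y).
Proof.
have [x' xE] := half_intE x; have [y' yE] := half_intE y.
rewrite /half_type /in_plane_group /half_map xE yE => hT.
(* Index in [positions]: [n] and [s] are the two low bits, and the centring of cmm adds 4. *)
exists (n + 2 * s + 4 * (if T is cmm then ~~ (2 %| x)%Z else false))%N, x', y'.
case: T hT => //; case: (2 %| x)%Z; case: (2 %| y)%Z => //=; case: s => //= _;
  case: n; split=> // -[u v] /=; rewrite ?expr0 ?expr1; congr pair; ring.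
Qed.

Lemma in_group_half_map T f :
  match T with pgg | pmg | pmm | cmm => true | _ => false end -> in_plane_group T f ->
  exists n s x y, half_type T s x y /\ forall P, f P = half_map n s x y P.
Proof.
move=> hT [k [x' [y' [kT fE]]]].
pose o (b : bool) : int := if b then 1 else 0.
exists (odd k), (odd (k %/ 2)).
exists (2 * x' + o (match T with pmm => false | cmm => 4 <= k | _ => 2 <= k end)%N).
exists (2 * y' + o (match T with pgg => 2 <= k | cmm => 4 <= k | _ => false end)%N).
have even2 z : (2 %| 2 * z + o false)%Z by rewrite /o; lia.
have odd2 z : (2 %| 2 * z + o true)%Z = false by rewrite /o; lia.
case: T hT kT fE => // _; case: k => [|[|[|[|[|[|[|[|k]]]]]]]] //= _ fE;
  (split; [by rewrite /half_type ?even2 ?odd2|]); move=> P; rewrite fE /half_map /o /= ?expr0 ?expr1;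
  congr pair; rewrite !rmorphD !rmorphM /=; field; done.
Qed.

(** Coordinates along the two diagonal directions, with the half-turn centre (0, kap / 2) as
    origin. *)
Definition diagonal_coordinates (kap X Y : int) (P : point) : point :=
  ((P.1 - P.2 + kap%:~R / 2) / X%:~R, (P.1 + P.2 - kap%:~R / 2) / Y%:~R).

Lemma affine_diagonal (kap X Y : int) : X != 0 -> Y != 0 ->
  affine_bijection (diagonal_coordinates kap X Y).
Proof.
move=> X0 Y0; have X0' : X%:~R != 0 :> rat by rewrite intr_eq0.
have Y0' : Y%:~R != 0 :> rat by rewrite intr_eq0.
exists (X%:~R^-1), (- X%:~R^-1), (Y%:~R^-1), (Y%:~R^-1).
exists (kap%:~R / 2 / X%:~R), (- (kap%:~R / 2) / Y%:~R); split.
  rewrite mulNr opprK -mulr2n mulrn_eq0 /= mulf_eq0 !invr_eq0.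
  by rewrite negb_or X0' Y0'.
by move=> P; rewrite /diagonal_coordinates; congr pair; field; rewrite ?X0' ?Y0'.
Qed.

(* Twice the shifts, in the coordinates S = x + y, D = x - y centred at
   (- kap / 2, kap / 2), measured in the units X and Y. *)
Definition diagonal_shift (kap X Y : int) (t : grid_isometry) (x y : int) :=
  [/\ negx t = negy t,
      2 * (shiftx t - shifty t + (if swap t (+) negx t then kap else 0)) = X * x
    & 2 * (shiftx t + shifty t - (if negx t then kap else 0)) = Y * y].

Lemma diagonal_shiftP (kap X Y : int) t x y P : X != 0 -> Y != 0 ->
  diagonal_shift kap X Y t x y ->
  diagonal_coordinates kap X Y (act_point t P) =
  half_map (negx t) (swap t) x y (diagonal_coordinates kap X Y P).
Proof.
move=> X0 Y0; have X0' : X%:~R != 0 :> rat by rewrite intr_eq0.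
have Y0' : Y%:~R != 0 :> rat by rewrite intr_eq0.
case: t P => sw n n' u v [P1 P2] [/= <- hx hy].
have {}hx : x%:~R / 2 = (u%:~R - v%:~R + (if sw (+) n then kap%:~R else 0)) / X%:~R :> rat.
  have := congr1 (fun z : int => z%:~R : rat) hx.
  rewrite !intrM intrD intrB => h.
  have -> : x%:~R = 2 * (u%:~R - v%:~R + (if sw (+) n then kap else 0)%:~R) / X%:~R :> rat.
    by rewrite h; field.
  by case: (sw (+) n); field.
have {}hy : y%:~R / 2 = (u%:~R + v%:~R - (if n then kap%:~R else 0)) / Y%:~R :> rat.
  have := congr1 (fun z : int => z%:~R : rat) hy.
  rewrite !intrM intrB intrD => h.
  have -> : y%:~R = 2 * (u%:~R + v%:~R - (if n then kap else 0)%:~R) / Y%:~R :> rat.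
    by rewrite h; field.
  by case: (n); field.
rewrite /diagonal_coordinates /half_map /act_point /= hx hy.
by case: sw {hx}; case: n {hy}; rewrite /= ?expr0 ?expr1; congr pair; field; rewrite ?X0' ?Y0'.
Qed.

(** This reduces the type of a group to parity conditions on its shifts, measured in half-units. *)
Lemma diagonal_type (Gam : grid_isometry -> Prop) T (kap X Y : int) :
  match T with pgg | pmg | pmm | cmm => true | _ => false end ->
  X != 0 -> Y != 0 ->
  (forall t, Gam t -> exists x y,
     half_type T (swap t) x y /\ diagonal_shift kap X Y t x y) ->
  (forall n s x y, half_type T s x y -> exists2 t, Gam t &
     [/\ negx t = n, swap t = s & diagonal_shift kap X Y t x y]) ->
  of_crystallographic_type Gam T.
Proof.
move=> hT X0 Y0 h1 h2; exists (diagonal_coordinates kap X Y).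
split; first exact: affine_diagonal.
split=> [t /h1[x [y [xy ds]]]|f /(in_group_half_map hT)[n [s [x [y [xy fE]]]]]].
  exists (half_map (negx t) (swap t) x y); first exact: half_map_in_group.
  by move=> P; apply: diagonal_shiftP.
have [t tG [nE sE ds]] := h2 n _ _ _ xy.
by exists t => // P; rewrite (diagonal_shiftP _ X0 Y0 ds) nE sE fE.
Qed.


(** The glides here translate along x - y, whereas those of the standard pg translate along the
    second coordinate; so [psi] exchanges the diagonal coordinates. *)
Lemma pg_type (Gam : grid_isometry -> Prop) (kap X Y : int) :
  X != 0 -> Y != 0 ->
  (forall t, Gam t -> swap t = negx t /\ exists x y,
     [/\ (2 %| y)%Z, (2 %| x)%Z = ~~ swap t & diagonal_shift kap X Y t x y]) ->
  (forall s x y, (2 %| y)%Z -> (2 %| x)%Z = ~~ s -> exists2 t, Gam t &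
     [/\ negx t = s, swap t = s & diagonal_shift kap X Y t x y]) ->
  of_crystallographic_type Gam pg.
Proof.
move=> X0 Y0 h1 h2; have X0' : X%:~R != 0 :> rat by rewrite intr_eq0.
have Y0' : Y%:~R != 0 :> rat by rewrite intr_eq0.
pose psi P := let Q := diagonal_coordinates kap X Y P in (Q.2, Q.1).
have actE t x y P : swap t = negx t -> diagonal_shift kap X Y t x y ->
    psi (act_point t P) =
    ((-1) ^+ negx t * (psi P).1 + y%:~R / 2, (psi P).2 + x%:~R / 2).
  move=> sn ds; rewrite /psi (diagonal_shiftP _ X0 Y0 ds) /half_map /= sn addbb.
  by rewrite expr0 mul1r.
exists psi; split.
  exists (Y%:~R^-1), (Y%:~R^-1), (X%:~R^-1), (- X%:~R^-1).
  exists (- (kap%:~R / 2) / Y%:~R), (kap%:~R / 2 / X%:~R); split.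
    rewrite mulrN -opprD oppr_eq0 -mulr2n mulrn_eq0 /=.
    by rewrite mulf_eq0 !invr_eq0 negb_or X0' Y0'.
  by move=> P; rewrite /psi /=; congr pair; field; rewrite ?X0' ?Y0'.
split=> [t /h1[sn [x [y [ye xe ds]]]]|f [k [x [y [k2 fE]]]]].
  exists (fun P => ((-1) ^+ negx t * P.1 + y%:~R / 2, P.2 + x%:~R / 2)); last first.
    by move=> P; apply: actE.
  have [x' xE] := half_intE x; have [y' yE] := half_intE y.
  exists (negx t), y', x'; split; first by case: (negx t).
  move=> P; rewrite xE yE ye xe sn; case: (negx t) => /=;
    by rewrite ?expr0 ?expr1; congr pair; ring.
have [t tG [nE sE ds]] := h2 (k == 1%N) (2 * y + (k == 1%N)%:Z) (2 * x)
  ltac:(lia) ltac:(case: (k == 1%N); lia).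
exists t => // P; rewrite (actE _ _ _ _ _ ds) ?nE ?sE // fE.
case: k k2 {nE sE ds fE} => [|[|]] //= _; rewrite ?expr0 ?expr1;
  by rewrite !rmorphD !rmorphM /=; congr pair; field.
Qed.

(** The map [psi] takes T and V to the unit translations and the centre (0, kap / 2) to the
    origin. *)
Lemma p2_type (Gam : grid_isometry -> Prop) (l kap p : int) : p != 0 ->
  (forall t, Gam t <-> exists a b, [/\ swap t = false, negx t = negy t,
     shiftx t = 2 * a
   & shifty t = 2 * l * a + p * b + (if negx t then kap else 0)]) ->
  of_crystallographic_type Gam p2.
Proof.
move=> p0 GE; have p0' : p%:~R != 0 :> rat by rewrite intr_eq0.
pose psi (P : point) : point :=
  (P.1 / 2, (P.2 - kap%:~R / 2 - l%:~R * P.1) / p%:~R).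
have actE n a b P :
    psi (act_point (GridIsometry false n n (2 * a)
      (2 * l * a + p * b + (if n then kap else 0))) P) =
    ((-1) ^+ n * (psi P).1 + a%:~R, (-1) ^+ n * (psi P).2 + b%:~R).
  case: P => P1 P2; rewrite /psi /act_point /=; case: n; rewrite /= ?expr0 ?expr1;
    rewrite !rmorphD !rmorphM /=; congr pair; field; by rewrite ?p0'.
exists psi; split.
  exists (2^-1), 0, (- l%:~R / p%:~R), (p%:~R^-1), 0, (- (kap%:~R / 2) / p%:~R).
  split; first by rewrite mul0r subr0 mulf_neq0 // invr_eq0.
  by move=> P; rewrite /psi; congr pair; field; rewrite ?p0'.
split=> [[sw n n' u v] /GE[a [b [/= -> <- -> ->]]]|f [k [x [y [k2 fE]]]]].
  exists (fun P => ((-1) ^+ n * P.1 + a%:~R, (-1) ^+ n * P.2 + b%:~R)) => [|P];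
    last exact: actE.
  exists n, a, b; split; first by case: (n).
  by move=> P; case: (n); rewrite /= ?expr0 ?expr1 ?mul1r ?mulN1r.
exists (GridIsometry false (k == 1%N) (k == 1%N) (2 * x)
      (2 * l * x + p * y + (if k == 1%N then kap else 0))).
  by apply/GE; exists x, y.
move=> P; rewrite actE fE.
by case: k k2 {fE} => [|[|]] //= _; rewrite ?expr0 ?expr1 ?mul1r ?mulN1r.
Qed.

(** * Types of G1 and H1 for the shapes of parameters in use *)

Section Shapes.

Variables (sT sH sR sV : bool).
Local Notation G l kap q p :=
  (fun t => exists s, weave_group sT sH sR sV l kap q p t s).
Local Notation H l kap q p :=
  (fun t => weave_group sT sH sR sV l kap q p t (swap t)).

(** As q = p / 2, elements with [swap] shift x - y by an odd number of half-units; as 2 h + 1 is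
    odd, the same holds for x + y. *)
Lemma G1_pgg (h : int) :
  of_crystallographic_type (G 1 0 (2 * (2 * h + 1)) (4 * (2 * h + 1))) pgg.
Proof.
pose d (s n : bool) : int := if s then if n then 1 else -1 else 0.
apply: (@diagonal_type _ _ 0 (4 * (2 * h + 1)) 4) => //; first by lia.
  move=> [sw n n' u v] [s [a [b [/= <- -> -> _]]]].
  exists (- 2 * b + d sw n), (2 * a + (2 * b - d sw n) * (2 * h + 1)).
  split; first by rewrite /half_type /= /d; case: sw; case: n; lia.
  by split; rewrite // /vertical_shift /= /d; case: sw; case: n => /=; ring.
move=> n s x y xy.
have [b bE] : exists b, x = - 2 * b + d s n.
  exists (- ((x - d s n) %/ 2)%Z); move: xy; rewrite /half_type /d.
  by case: (s); case: (n); lia.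
have [a aE] : exists a, y = 2 * a + (2 * b - d s n) * (2 * h + 1).
  exists ((y - (2 * b - d s n) * (2 * h + 1)) %/ 2)%Z; move: xy; rewrite /half_type /d.
  by case: (s); case: (n); lia.
exists (GridIsometry s n n (2 * a)
  (vertical_shift 1 0 (2 * (2 * h + 1)) (4 * (2 * h + 1)) (GridIsometry s n n 0 0) a b)).
  by eexists; exists a, b; split.
split=> //; rewrite bE aE; split; rewrite // /vertical_shift /= /d.
  by case: (s); case: (n) => /=; ring.
by case: (s); case: (n) => /=; ring.
Qed.

(** As kap = p / 2, elements with [swap] shift x - y by an odd number of half-units, while x + y is
    always shifted by an even number. *)
Lemma G1_pmg (B : int) : B != 0 ->
  of_crystallographic_type (G 1 (2 * B) 0 (4 * B)) pmg.
Proof.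
pose d (s n : bool) : int := if s then if n then -1 else 1 else 0.
move=> B0; apply: (@diagonal_type _ _ (2 * B) (4 * B) 4) => //; first by lia.
  move=> [sw n n' u v] [s [a [b [/= <- -> -> _]]]].
  exists (- 2 * b + d sw n), (2 * a + 2 * (B * b)).
  split; first by rewrite /half_type /= /d; case: sw; case: n; lia.
  by split; rewrite // /vertical_shift /= /d; case: sw; case: n => /=; ring.
move=> n s x y xy.
have [b bE] : exists b, x = - 2 * b + d s n.
  exists (- ((x - d s n) %/ 2)%Z); move: xy; rewrite /half_type /d.
  by case: (s); case: (n); lia.
have [a aE] : exists a, y = 2 * a + 2 * (B * b).
  by exists ((y - 2 * (B * b)) %/ 2)%Z; move: xy; rewrite /half_type; lia.
exists (GridIsometry s n n (2 * a)
  (vertical_shift 1 (2 * B) 0 (4 * B) (GridIsometry s n n 0 0) a b)).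
  by eexists; exists a, b; split.
split=> //; rewrite bE aE; split; rewrite // /vertical_shift /= /d.
  by case: (s); case: (n) => /=; ring.
by case: (s); case: (n) => /=; ring.
Qed.

Lemma G1_pmm (B : int) : B != 0 ->
  of_crystallographic_type (G 1 0 0 (4 * B)) pmm.
Proof.
move=> B0; apply: (@diagonal_type _ _ 0 (4 * B) 4) => //; first by lia.
  move=> [sw n n' u v] [s [a [b [/= <- -> -> _]]]].
  exists (- 2 * b), (2 * a + 2 * (B * b)).
  split; first by rewrite /half_type /=; lia.
  by split; rewrite // /vertical_shift /=; case: sw; case: n => /=; ring.
move=> n s x y xy.
have [b bE] : exists b, x = - 2 * b.
  by exists (- (x %/ 2)%Z); move: xy; rewrite /half_type; lia.
have [a aE] : exists a, y = 2 * a + 2 * (B * b).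
  by exists ((y - 2 * (B * b)) %/ 2)%Z; move: xy; rewrite /half_type; lia.
exists (GridIsometry s n n (2 * a)
  (vertical_shift 1 0 0 (4 * B) (GridIsometry s n n 0 0) a b)).
  by eexists; exists a, b; split.
split=> //; rewrite bE aE; split; rewrite // /vertical_shift /=.
  by case: (s); case: (n) => /=; ring.
by case: (s); case: (n) => /=; ring.
Qed.

(** Since p is twice an odd number, the parity of b shows in both coordinates, which is the
    centring. *)
Lemma G1_cmm (h : int) :
  of_crystallographic_type (G 1 0 0 (2 * (2 * h + 1))) cmm.
Proof.
apply: (@diagonal_type _ _ 0 (4 * (2 * h + 1)) 4) => //; first by lia.
  move=> [sw n n' u v] [s [a [b [/= <- -> -> _]]]].
  exists (- b), (2 * a + 2 * (h * b) + b).
  split; first by rewrite /half_type /=; lia.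
  by split; rewrite // /vertical_shift /=; case: sw; case: n => /=; ring.
move=> n s x y xy.
have [a aE] : exists a, y = 2 * a + 2 * (h * - x) - x.
  by exists ((y - (2 * (h * - x) - x)) %/ 2)%Z; move: xy; rewrite /half_type; lia.
exists (GridIsometry s n n (2 * a)
  (vertical_shift 1 0 0 (2 * (2 * h + 1)) (GridIsometry s n n 0 0) a (- x))).
  by eexists; exists a, (- x); split.
split=> //; rewrite aE; split; rewrite // /vertical_shift /=.
  by case: (s); case: (n) => /=; ring.
by case: (s); case: (n) => /=; ring.
Qed.

(** With this slope the centring is governed by a, the exponent of T, so the sign can sit on T, as
    [weave_H1_not_transitive] requires. *)
Lemma G1_cmm_sparse (B : int) : B != 0 ->
  of_crystallographic_type (G (1 + 4 * B) 0 0 (16 * B)) cmm.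
Proof.
move=> B0; apply: (@diagonal_type _ _ 0 (16 * B) 8) => //; first by lia.
  move=> [sw n n' u v] [s [a [b [/= <- -> -> _]]]].
  exists (- a - 2 * b), (a + 2 * (B * a) + 4 * (B * b)).
  split; first by rewrite /half_type /=; lia.
  by split; rewrite // /vertical_shift /=; case: sw; case: n => /=; ring.
move=> n s x y xy; pose a := y + 2 * (B * x).
have [b bE] : exists b, x = - a - 2 * b.
  by exists (- ((x + a) %/ 2)%Z); move: xy; rewrite /half_type /a; lia.
have yE : y = a + 2 * (B * a) + 4 * (B * b).
  have -> : y = a - 2 * (B * x) by rewrite /a; ring.
  by rewrite [in LHS]bE; ring.
exists (GridIsometry s n n (2 * a)
  (vertical_shift (1 + 4 * B) 0 0 (16 * B) (GridIsometry s n n 0 0) a b)).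
  by eexists; exists a, b; split.
split=> //; split; rewrite // /vertical_shift /=.
  by rewrite [x in RHS]bE; case: (s); case: (n) => /=; ring.
by rewrite [y in RHS]yE; case: (s); case: (n) => /=; ring.
Qed.

End Shapes.

(** The sign is the parity of a + B b, which is also the shift of x + y in half-units twice as long
    as in [G1_pmg]. Equating it with [swap] removes the mirrors and leaves glides only. *)
Lemma H1_pgg_of_pmg (sV : bool) (B : int) : B != 0 -> sV = ~~ (2 %| B)%Z ->
  of_crystallographic_type
    (fun t => weave_group true false false sV 1 (2 * B) 0 (4 * B) t (swap t)) pgg.
Proof.
pose d (s n : bool) : int := if s then if n then -1 else 1 else 0.
move=> B0 sB.
have signE t a b : sign_of true false false sV t a b = ~~ (2 %| a + B * b)%Z.
  rewrite /sign_of /= !addbF {1}/sgn /= sB.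
  have [[B' ->]|[B' ->]] := evenVodd B.
    have -> : (2 %| 2 * B')%Z by lia.
    by rewrite addbF -mulrA; lia.
  have -> : (2 %| 2 * B' + 1)%Z = false by lia.
  by rewrite /sgn /= mulrDl -mulrA mul1r; lia.
apply: (@diagonal_type _ _ (2 * B) (4 * B) 8) => //; first by lia.
  move=> [sw n n' u v] [a [b [/= <- -> -> sE]]].
  exists (- 2 * b + d sw n), (a + B * b).
  rewrite signE in sE.
  split; first by move: sE; rewrite /half_type /= /d; case: sw; case: n; lia.
  by split; rewrite // /vertical_shift /= /d; case: (sw); case: (n) => /=; ring.
move=> n s x y xy.
have [b bE] : exists b, x = - 2 * b + d s n.
  exists (- ((x - d s n) %/ 2)%Z); move: xy; rewrite /half_type /d.
  by case: (s); case: (n); lia.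
have [a aE] : exists a, y = a + B * b by exists (y - B * b); ring.
exists (GridIsometry s n n (2 * a)
  (vertical_shift 1 (2 * B) 0 (4 * B) (GridIsometry s n n 0 0) a b)).
  by exists a, b; split=> //; rewrite signE -aE; case/andP: xy => _ /eqP.
split=> //; rewrite bE aE; split; rewrite // /vertical_shift /= /d.
  by case: (s); case: (n) => /=; ring.
by case: (s); case: (n) => /=; ring.
Qed.

(** The sign is the parity of b, the common parity of both shifts; equating it with [swap] turns the
    condition for cmm into that for pgg. *)
Lemma H1_pgg_of_cmm (h : int) :
  of_crystallographic_type
    (fun t => weave_group false false false true 1 0 0 (2 * (2 * h + 1)) t (swap t))
    pgg.
Proof.
apply: (@diagonal_type _ _ 0 (4 * (2 * h + 1)) 4) => //; first by lia.
  move=> [sw n n' u v] [a [b [/= <- -> -> sE]]].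
  exists (- b), (2 * a + 2 * (h * b) + b).
  split; first by rewrite /half_type /= sE /sign_of /= /sgn /=; lia.
  by split; rewrite // /vertical_shift /=; case: (sw); case: (n) => /=; ring.
move=> n s x y xy.
have [a aE] : exists a, y = 2 * a + 2 * (h * - x) - x.
  by exists ((y - (2 * (h * - x) - x)) %/ 2)%Z; move: xy; rewrite /half_type; lia.
exists (GridIsometry s n n (2 * a)
  (vertical_shift 1 0 0 (2 * (2 * h + 1)) (GridIsometry s n n 0 0) a (- x))).
  exists a, (- x); split=> //; move: xy; rewrite /half_type /sign_of /sgn /=.
  by case: (s); lia.
split=> //; rewrite aE; split; rewrite // /vertical_shift /=.
  by case: (s); case: (n) => /=; ring.
by case: (s); case: (n) => /=; ring.
Qed.

Lemma H1_pgg_of_cmm_sparse (B : int) : B != 0 ->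
  of_crystallographic_type
    (fun t => weave_group true false false false (1 + 4 * B) 0 0 (16 * B) t (swap t))
    pgg.
Proof.
move=> B0; apply: (@diagonal_type _ _ 0 (16 * B) 8) => //; first by lia.
  move=> [sw n n' u v] [a [b [/= <- -> -> sE]]].
  exists (- a - 2 * b), (a + 2 * (B * a) + 4 * (B * b)).
  split; first by rewrite /half_type /= sE /sign_of /= /sgn /=; lia.
  by split; rewrite // /vertical_shift /=; case: (sw); case: (n) => /=; ring.
move=> n s x y xy; pose a := y + 2 * (B * x).
have [b bE] : exists b, x = - a - 2 * b.
  by exists (- ((x + a) %/ 2)%Z); move: xy; rewrite /half_type /a; lia.
have yE : y = a + 2 * (B * a) + 4 * (B * b).
  have -> : y = a - 2 * (B * x) by rewrite /a; ring.
  by rewrite [in LHS]bE; ring.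
exists (GridIsometry s n n (2 * a)
  (vertical_shift (1 + 4 * B) 0 0 (16 * B) (GridIsometry s n n 0 0) a b)).
  exists a, b; split=> //; move: xy; rewrite /half_type /sign_of /sgn /= /a.
  by case: (s); lia.
split=> //; split; rewrite // /vertical_shift /=.
  by rewrite [x in RHS]bE; case: (s); case: (n) => /=; ring.
by rewrite [y in RHS]yE; case: (s); case: (n) => /=; ring.
Qed.

(** Only the half-turn carries a sign, so [swap] and negation go together in H1. The elements having
    both are glides along x - y, by an odd number of half-units because kap - q is half of 4 B up to
    sign. *)
Lemma H1_pg (kap q B : int) : B != 0 -> `|kap - q| = 2 * `|B| ->
  of_crystallographic_type
    (fun t => weave_group false true false false 1 kap q (4 * B) t (swap t)) pg.
Proof.
move=> B0 hkq.
have [d dE dd] : exists2 d : int, kap - q = 2 * B * d & d = 1 \/ d = -1.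
  have [h|h] : kap - q = 2 * B \/ kap - q = - (2 * B) by lia.
    by exists 1; [rewrite mulr1|left].
  by exists (-1); [rewrite mulrN1|right].
apply: (@pg_type _ (kap - q) (4 * B) 4) => //; first by lia.
  move=> [sw n n' u v] [a [b [/= <- -> -> sE]]].
  have {}sE : sw = n by rewrite sE /sign_of /=; case: (n).
  rewrite sE; split=> //.
  exists (- 2 * b - (if n then d else 0)), (2 * a + 2 * (B * b)).
  split; [by lia|by case: (n); lia|split=> //=].
    rewrite addbb /vertical_shift /=; case: (n); last by ring.
    transitivity (2 * (- (4 * B * b) - (kap - q))); first by ring.
    by rewrite dE; ring.
  by rewrite /vertical_shift /=; case: (n); ring.
move=> s x y ye xe.
have [b bE] : exists b, x = - 2 * b - (if s then d else 0).
  exists (- ((x + (if s then d else 0)) %/ 2)%Z); move: xe; case: (s); lia.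
have [a aE] : exists a, y = 2 * a + 2 * (B * b).
  by exists ((y - 2 * (B * b)) %/ 2)%Z; lia.
exists (GridIsometry s s s (2 * a)
  (vertical_shift 1 kap q (4 * B) (GridIsometry s s s 0 0) a b)).
  by exists a, b; split=> //; rewrite /sign_of /=; case: (s).
split=> //; split; rewrite // /vertical_shift /=.
  rewrite addbb bE; case: (s); last by ring.
  transitivity (2 * (- (4 * B * b) - (kap - q))); first by ring.
  by rewrite dE; ring.
by rewrite aE; case: (s); ring.
Qed.

Lemma H1_p2 (l kap q p : int) : p != 0 ->
  of_crystallographic_type
    (fun t => weave_group false false false false l kap q p t (swap t)) p2.
Proof.
move=> p0; apply: (@p2_type _ l kap p) => // -[sw n n' u v]; split.
  move=> [a [b [/= <- -> -> sE]]]; exists a, b.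
  have {sE}-> : sw = false by rewrite sE /sign_of.
  by rewrite /vertical_shift /= addr0.
move=> [a [b [/= -> <- -> ->]]]; exists a, b.
by rewrite /vertical_shift /= addr0.
Qed.

(** * Words given by finite data, and their decidable properties *)

Lemma dvdzDM (d m k : int) : (d %| m + d * k)%Z = (d %| m)%Z.
Proof. by rewrite rpredDr // dvdz_mulr. Qed.

(* Words of period circumference * C: a word of period 16 with the letters at
   finitely many places a * C + b complemented, b being small.  As C is large and
   C = 1 mod 16, all the properties needed can be decided on the pairs (a, b). *)
Record word_data := WordData {
  ground : seq bool;
  circumference : int;
  flips : seq (int * int)
}.

Definition ground_at (d : word_data) (j : int) : bool :=
  nth false (ground d) `|(j %% 16)%Z|.

Definition word (d : word_data) (C j : int) : bool :=
  ground_at d j (+)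
  has (fun x : int * int => (circumference d * C %| j - (x.1 * C + x.2))%Z) (flips d).

(* Value of the word at a * C + b. *)
Definition symbolic (d : word_data) (a b : int) : bool :=
  ground_at d (a + b) (+)
  has (fun x : int * int => (circumference d %| a - x.1)%Z && (b == x.2)) (flips d).

Definition well_formed (d : word_data) : bool :=
  [&& circumference d \in [:: 4; 8; 16],
      all (fun r : nat => ground_at d (r%:Z + circumference d) == ground_at d r)
          (iota 0 16)
    & all (fun x : int * int => `|x.2| <= 20) (flips d)].

(* word (+- j + h C) = s (+) word j for all j = e mod 4 *)
Definition class_symmetric (d : word_data) (e : nat) (neg : bool) (h : int)
    (s : bool) : bool :=
  let D := (-1) ^+ neg in
  [&& all (fun r : nat => (r %% 4 == e)%N ==>
             (ground_at d (D * r%:Z + h) == s (+) ground_at d r)) (iota 0 16),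
      all (fun x : int * int => ((x.1 + x.2) %% 4 == e)%Z ==>
             has (fun y : int * int => (circumference d %| D * x.1 + h - y.1)%Z &&
                           (D * x.2 == y.2)) (flips d)) (flips d)
    & all (fun y : int * int => ((D * (y.1 - h + y.2)) %% 4 == e)%Z ==>
             has (fun x : int * int => (circumference d %| D * x.1 + h - y.1)%Z &&
                           (D * x.2 == y.2)) (flips d)) (flips d)].

Definition shows (M : seq bool) (u : int -> bool) (s : bool) : bool :=
  all (fun i : nat => u i%:Z == s (+) nth false M i) (iota 0 (size M)).

Definition occurs_only (d : word_data) (M : seq bool) (neg : bool)
    (P : int -> int -> bool) : bool :=
  let D := (-1) ^+ neg in
  (size M <= 10)%N &&
  all (fun s =>
    all (fun r : nat =>
      ~~ shows M (fun i => ground_at d (r%:Z + D * i)) s) (iota 0 16)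
    && all (fun x : int * int => all (fun t : nat =>
         shows M (fun i => symbolic d x.1 (x.2 - D * t%:Z + D * i)) s ==>
           P x.1 (x.2 - D * t%:Z)) (iota 0 (size M))) (flips d))
    [:: true; false].

(** The factor [M] starts at [k], recurs up to complementation only at multiples of p C from there,
    and never occurs reversed. *)
Definition chiral_marker (d : word_data) (M : seq bool) (k : int * int)
    (p : int) : bool :=
  [&& `|k.2| <= 20, shows M (fun i => symbolic d k.1 (k.2 + i)) false,
      occurs_only d M false (fun a b => (p %| a - k.1)%Z && (b == k.2)),
      occurs_only d M true (fun _ _ => false) & (p %| circumference d)%Z].

Definition symbolic_incomparable (d : word_data) (a b : int) (s : bool) : bool :=
  has (fun x : int * int =>
    ~~ symbolic d x.1 x.2 && (s (+) symbolic d (a - x.1) (b - x.2)))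
    [seq (i%:Z, j%:Z - 12) | i <- iota 0 16, j <- iota 0 25] &&
  has (fun x : int * int =>
    symbolic d x.1 x.2 && ~~ (s (+) symbolic d (a - x.1) (b - x.2)))
    [seq (i%:Z, j%:Z - 12) | i <- iota 0 16, j <- iota 0 25].

Section Words.

Variables (d : word_data) (C h0 : int).
Hypotheses (C16 : C = 1 + 16 * h0) (C80 : 80 < C) (wf : well_formed d).

Local Notation A := (circumference d).
Local Notation w := (word d C).

Lemma ground_atE (i j : int) : (16 %| i - j)%Z -> ground_at d i = ground_at d j.
Proof. by rewrite /ground_at => h; congr (nth _ _ `|_|%N); lia. Qed.

Lemma ground_at_nat (j : int) : exists2 r : nat, (r < 16)%N &
  (16 %| j - r%:Z)%Z.
Proof. by exists `|(j %% 16)%Z|%N; lia. Qed.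

Lemma circumferenceP : [\/ A = 4, A = 8 | A = 16].
Proof.
case/and3P: wf; rewrite !inE => /or3P[] /eqP-> _ _;
  by [apply: Or31|apply: Or32|apply: Or33].
Qed.

Lemma ground_at_period (j k : int) : ground_at d (j + A * k) = ground_at d j.
Proof.
have step i : ground_at d (i + A) = ground_at d i.
  have [r r16 er] := ground_at_nat i.
  case/and3P: wf => _ /allP/(_ r) + _.
  rewrite mem_iota r16 => /(_ isT)/eqP.
  rewrite (@ground_atE (i + A) (r%:Z + A)) ?(@ground_atE i r) //.
  by rewrite opprD addrACA subrr addr0.
have pos (n : nat) i : ground_at d (i + A * n%:Z) = ground_at d i.
  elim: n => [|n IH]; first by rewrite mulr0 addr0.
  by rewrite -IH -[RHS]step; congr ground_at; rewrite intS; ring.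
case: (intP k) => [|n|n]; first by rewrite mulr0 addr0.
  exact: pos.
by rewrite -[RHS](@ground_atE (j + A * - n.+1%:Z + A * n.+1%:Z)) ?pos //; lia.
Qed.

Lemma flips_bound x : x \in flips d -> `|x.2| <= 20.
Proof. by case/and3P: wf => _ _ /allP/(_ x). Qed.

Lemma word_shift (j k : int) : w (j + A * C * k) = w j.
Proof.
rewrite /word; congr (_ (+) _).
  by rewrite -(ground_at_period j (C * k)) mulrA.
apply: eq_has => x; rewrite -[RHS](dvdzDM _ _ k); congr (_ %| _)%Z; ring.
Qed.

(** The offsets differ by at most 80 < C, so divisibility by C already forces them to be equal. *)
Lemma dvdz_pair (a b x1 x2 : int) : `|b| <= 60 -> `|x2| <= 20 ->
  (A * C %| a * C + b - (x1 * C + x2))%Z = (A %| a - x1)%Z && (b == x2).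
Proof.
move=> hb hx.
have -> : a * C + b - (x1 * C + x2) = (a - x1) * C + (b - x2) by ring.
have [->|neq] := eqVneq b x2.
  by rewrite subrr addr0 andbT dvdz_mul2r //; lia.
rewrite andbF; apply/negP => /dvdzP[z] hz.
have {}hz : b - x2 = (A * z - (a - x1)) * C by lia.
move: (A * z - _) hz => y hz.
have y0 : y != 0 by apply: contraNneq neq => y0; rewrite y0 mul0r in hz; lia.
have : C <= `|y| * C by rewrite ler_peMl; lia.
have <- : `|b - x2| = `|y| * C by rewrite hz normrM [`|C|]ger0_norm //; lia.
lia.
Qed.

Lemma symbolicP (a b : int) : `|b| <= 60 -> w (a * C + b) = symbolic d a b.
Proof.
move=> hb; rewrite /word /symbolic; congr (_ (+) _).
  by apply: ground_atE; rewrite C16; lia.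
by apply: eq_in_has => x /flips_bound; apply: dvdz_pair.
Qed.

(** Ground and flips are matched separately, the flips in both directions. As 4 divides both the
    circumference and C - 1, the class of a C + b modulo 4 is that of a + b. *)
Lemma class_symmetricP (e : nat) (neg : bool) (h : int) (s : bool) (j : int) :
  class_symmetric d e neg h s -> (j %% 4)%Z = e ->
  w ((-1) ^+ neg * j + h * C) = s (+) w j.
Proof.
case/and3P; set D := (-1) ^+ neg => hg hx hy je.
have DD : D * D = 1 by rewrite /D -expr2 sqrr_sign.
rewrite /word addbA; congr (_ (+) _).
  have [r r16 er] := ground_at_nat j.
  move/allP: hg => /(_ r); rewrite mem_iota r16 => /(_ isT).
  have -> /= : (r %% 4 == e)%N by lia.
  rewrite -(@ground_atE j r) // => /eqP <-; apply: ground_atE.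
  have -> : D * j + h * C - (D * r + h) = D * (j - r%:Z) + h * (C - 1) by ring.
  by rewrite rpredD ?dvdz_mull // C16; lia.
have A4 : (4 %| A)%Z by case: circumferenceP => ->.
have C4 : (4 %| C - 1)%Z by lia.
have key (x y : int * int) : (A %| D * x.1 + h - y.1)%Z -> D * x.2 = y.2 :> int ->
    (A * C %| D * j + h * C - (y.1 * C + y.2))%Z =
    (A * C %| j - (x.1 * C + x.2))%Z.
  move=> /dvdzP[z hz] h2.
  have -> : D * j + h * C - (y.1 * C + y.2) =
     D * (j - (x.1 * C + x.2)) + (A * C) * z by move: hz h2; nia.
  rewrite dvdzDM.
  by rewrite /D; case: (neg); rewrite ?expr0 ?expr1 ?mul1r ?mulN1r ?rpredN.
apply/hasP/hasP => -[x xX hxj].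
  move/allP: hy => /(_ x xX) /implyP.
  have -> : (D * (x.1 - h + x.2) %% 4 == e)%Z.
    have /dvdzP[z hz] : (4 %| D * j + h * C - (x.1 * C + x.2))%Z.
      by apply: dvdz_trans hxj; rewrite dvdz_mulr.
    have /dvdzP[c hc] := C4.
    have E : D * (x.1 - h + x.2) = j - 4 * (D * (z + (x.1 - h) * c)).
      have -> : x.2 = D * j + h * C - x.1 * C - z * 4 by lia.
      have -> : C = c * 4 + 1 by lia.
      transitivity (D * D * j - 4 * (D * (z + (x.1 - h) * c))); first by ring.
      by rewrite DD mul1r.
    by rewrite E -je; apply/eqP; lia.
  case/(_ isT)/hasP=> y yX /andP[h1 /eqP h2]; exists y => //.
  by rewrite -(key _ _ h1 h2).
move/allP: hx => /(_ x xX) /implyP.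
have -> : ((x.1 + x.2) %% 4 == e)%Z.
  have /dvdzP[z hz] : (4 %| j - (x.1 * C + x.2))%Z.
    by apply: dvdz_trans hxj; rewrite dvdz_mulr.
  have /dvdzP[c hc] := C4.
  by rewrite -je; apply/eqP; nia.
case/(_ isT)/hasP=> y yX /andP[h1 /eqP h2]; exists y => //.
by rewrite (key _ _ h1 h2).
Qed.

(** An occurrence of [M] either meets a flip, and then starts within the length of [M] from it, or
    lies in the ground, where only its position modulo 16 matters. The second case is excluded
    outright by [occurs_only]. *)
Lemma occurs_onlyP (M : seq bool) (neg : bool) (P : int -> int -> bool)
    (k : int) (s : bool) :
  occurs_only d M neg P -> shows M (fun i => w (k + (-1) ^+ neg * i)) s ->
  exists a b z, P a b /\ k = a * C + b + A * C * z.
Proof.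
have sT : s \in [:: true; false] by case: (s).
case/andP=> szM /allP/(_ s sT) /andP[]; set D : int := (-1) ^+ neg => hg /allP hx hk.
have [/hasP[[x1 x2] xX /hasP[t tM ht]]|/hasPn far] :=
  boolP (has (fun x : int * int => has (fun t : nat =>
    (A * C %| k + D * t%:Z - (x.1 * C + x.2))%Z) (iota 0 (size M))) (flips d)).
- case/dvdzP: ht => z /= hz; exists x1, (x2 - D * t%:Z), z.
  split; last by lia.
  move/allP: (hx _ xX) => /(_ t tM) /implyP; apply.
  apply/allP => i iM; move/allP: hk => /(_ i iM) /eqP <-.
  have kE : k + D * i%:Z = x1 * C + (x2 - D * t%:Z + D * i%:Z) + A * C * z by lia.
  rewrite kE word_shift symbolicP //.
  have := flips_bound xX => /=; move: tM iM; rewrite !mem_iota /D.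
  by case: (neg); rewrite ?expr0 ?expr1; lia.
- have [r r16 er] := ground_at_nat k.
  move/allP: hg => /(_ r); rewrite mem_iota r16 => /(_ isT) /negP[].
  apply/allP => i iM; move/allP: hk => /(_ i iM) /eqP <-; apply/eqP.
  rewrite /word (negPf (_ : ~~ has _ _)); last first.
    apply/hasPn => x /far /hasPn /(_ i iM); exact: contraNN.
  by rewrite addbF; apply: ground_atE; lia.
Qed.

Section Marker.

Variables (M : seq bool) (k0 : int * int) (p : int).
Hypothesis marker : chiral_marker d M k0 p.

Local Notation K := (k0.1 * C + k0.2).

Lemma marker_shows (u : int -> bool) (s : bool) :
  (forall i : nat, (i < size M)%N -> u i%:Z = s (+) w (K + i%:Z)) -> shows M u s.
Proof.
case/and5P: marker => k20 /allP Mk /andP[szM _] _ _ hu.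
apply/allP => i iM; have iM' : (i < size M)%N by move: iM; rewrite mem_iota.
rewrite hu // -addrA symbolicP; last by lia.
by rewrite (eqP (Mk i iM)).
Qed.

(** The shift carries the marker to another of its occurrences. *)
Lemma word_shift_dvdz (k : int) (s : bool) :
  (forall j, w (j + k) = s (+) w j) -> (p * C %| k)%Z.
Proof.
move=> hk; case/and5P: marker => _ _ occ _ /dvdzP[y yA].
have Mk : shows M (fun i => w (K + k + (-1) ^+ false * i)) s.
  by apply: marker_shows => i _; rewrite expr0 mul1r addrAC hk.
have [a [b [z [/andP[/dvdzP[x hx] /eqP bE] kE]]]] := occurs_onlyP occ Mk.
apply/dvdzP; exists (x + y * z).
have -> : k = (a - k0.1) * C + A * C * z by move: kE; rewrite bE; lia.
by rewrite hx yA; ring.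
Qed.

Lemma word_chiral (k : int) (s : bool) : ~ (forall j, w (k - j) = s (+) w j).
Proof.
move=> hk; case/and5P: marker => _ _ _ occ _.
have Mk : shows M (fun i => w (k - K + (-1) ^+ true * i)) s.
  apply: marker_shows => i _; rewrite -hk; congr (word _ _ _).
  by rewrite expr1; ring.
by have [a [b [z []]]] := occurs_onlyP occ Mk.
Qed.

End Marker.

Lemma symbolic_incomparableP (a b : int) (s : bool) : `|b| <= 1 ->
  symbolic_incomparable d a b s -> incomparable w (a * C + b) s.
Proof.
have cand x : x \in [seq (i%:Z, j%:Z - 12) | i <- iota 0 16, j <- iota 0 25] ->
    `|x.2| <= 12 by case/allpairsP=> -[i j] [_ + ->]; rewrite mem_iota /=; lia.
move=> b1 /andP[/hasP[x /cand xb /andP[/negPf h1 h2]]].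
case/hasP=> y /cand yb /andP[h3 /negPf h4].
have E (z : int * int) : `|z.2| <= 12 -> w (a * C + b - (z.1 * C + z.2)) =
    symbolic d (a - z.1) (b - z.2).
  move=> zb; have -> : a * C + b - (z.1 * C + z.2) = (a - z.1) * C + (b - z.2) by ring.
  by rewrite symbolicP //; lia.
split; [exists (x.1 * C + x.2)|exists (y.1 * C + y.2)];
  by rewrite ?E // symbolicP // (le_trans xb, le_trans yb).
Qed.

End Words.

(* The parameters of [weave] for the word [word thread C]: l = 1 + slope C, and
   kap, q, p are the multiples [hshift], [rshift], [vshift] of C. *)
Record weave_data := WeaveData {
  thread : word_data;
  tsign : bool; hsign : bool; rsign : bool; vsign : bool;
  slope : int; hshift : int; rshift : int; vshift : int;
  marker : seq bool;
  origin : int * int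
}.

(** The hypotheses of [weave_summary] in units of C. Classes 0 and 2 modulo 4 give [w_even], classes
    1 and 3 give [w_odd]; multiples of 4 [slope] C are periods of the word. A nonzero slope is
    allowed only in the shape of species 30. *)
Definition checked (d : weave_data) : bool :=
  let th := thread d in
  [&& well_formed th, chiral_marker th (marker d) (origin d) (vshift d),
      class_symmetric th 0 true (rshift d) (rsign d),
      class_symmetric th 2 true (rshift d - 2 * slope d) (rsign d (+) tsign d),
      class_symmetric th 1 false (hshift d - rshift d + 2 * slope d) (rsign d (+) hsign d (+) tsign d),
      class_symmetric th 3 false (hshift d - rshift d) (rsign d (+) hsign d),
      all (fun e => class_symmetric th e false (vshift d) (vsign d)) (iota 0 4),
      symbolic_incomparable th (hshift d + 2 * slope d) 1 (hsign d (+) tsign d),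
      symbolic_incomparable th (hshift d) (-1) (hsign d),
      [&& (2 %| hshift d)%Z, (2 %| rshift d)%Z, (2 %| vshift d)%Z & 0 < vshift d],
      (slope d == 0) || [&& slope d == 4, vshift d == 16, ~~ vsign d & hshift d == 0],
      (circumference th %| 4 * slope d)%Z, (vshift d %| 2 * hshift d - 2 * rshift d)%Z
    & sgn (vsign d) ((2 * hshift d - 2 * rshift d) %/ vshift d)%Z == sgn (tsign d) (hshift d %/ 2)%Z].

Definition weave_of (d : weave_data) (C : int) : prefabric :=
  weave (word (thread d) C) (tsign d) (hsign d) (1 + slope d * C) (hshift d * C).

Definition group_of (d : weave_data) (C : int) :=
  weave_group (tsign d) (hsign d) (rsign d) (vsign d) (1 + slope d * C) (hshift d * C) (rshift d * C)
    (vshift d * C).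

(** * From the computed checks to the properties of the design *)

Section Checked.

Variables (d : weave_data) (C h0 : int).
Hypotheses (C16 : C = 1 + 16 * h0) (C80 : 80 < C) (ok : checked d).

Local Notation w := (word (thread d) C).

Lemma class_symmetric_shift (e : nat) (neg : bool) (h : int) (s : bool) (x j : int) :
  class_symmetric (thread d) e neg h s -> (j %% 4)%Z = e ->
  w ((-1) ^+ neg * j + h * C + 4 * slope d * C * x) = s (+) w j.
Proof.
case/and5P: ok => wf _ _ _ /and5P[_ _ _ _ /and5P[_ _ _ /dvdzP[y yE] _]] cs je.
by rewrite -(class_symmetricP C16 C80 wf cs je) yE -[RHS](word_shift C16 C80 wf _ (y * x));
  congr (word _ _ _); ring.
Qed.

Lemma word_period j : w (j + vshift d * C) = vsign d (+) w j.
Proof.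
case/and5P: ok => wf _ _ _ /and5P[_ _ /allP cs _ _].
have j4 : (`|(j %% 4)%Z| < 4)%N by lia.
have {}cs := cs `|(j %% 4)%Z|%N ltac:(by rewrite mem_iota).
by rewrite -(class_symmetricP C16 C80 wf cs) ?expr0 ?mul1r //; lia.
Qed.

Lemma word_even a :
  sgn (tsign d) a (+) w (rshift d * C - 2 * (1 + slope d * C) * a) = rsign d (+) w (2 * a).
Proof.
case/and5P: ok => _ _ c0 c2 _.
have [[x ->]|[x ->]] := evenVodd a.
  rewrite sgn_double addFb -(@class_symmetric_shift _ _ _ _ (- x) _ c0); last by lia.
  by congr (word _ _ _); rewrite expr1; ring.
rewrite sgnS sgn_double addbF.
have := @class_symmetric_shift _ _ _ _ (- x) (2 * (2 * x + 1)) c2 ltac:(lia).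
rewrite expr1.
have -> : -1 * (2 * (2 * x + 1)) + (rshift d - 2 * slope d) * C + 4 * slope d * C * - x =
   rshift d * C - 2 * (1 + slope d * C) * (2 * x + 1) by ring.
by move=> ->; addb_solve.
Qed.

Lemma word_odd a :
  hsign d (+) sgn (tsign d) (a + 1)
    (+) w (hshift d * C - 1 - rshift d * C + 2 * (1 + slope d * C) * (a + 1)) =
  rsign d (+) w (2 * a + 1).
Proof.
case/and5P: ok => _ _ _ _ /and5P[c1 c3 _ _ _].
have [[x ->]|[x ->]] := evenVodd a.
  rewrite sgnS sgn_double addbF.
  have := @class_symmetric_shift _ _ _ _ x (2 * (2 * x) + 1) c1 ltac:(lia).
  rewrite expr0.
  have -> : 1 * (2 * (2 * x) + 1) + (hshift d - rshift d + 2 * slope d) * C + 4 * slope d * C * x =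
    hshift d * C - 1 - rshift d * C + 2 * (1 + slope d * C) * (2 * x + 1) by ring.
  by move=> ->; addb_solve.
have -> : 2 * x + 1 + 1 = 2 * (x + 1) by ring.
rewrite sgn_double addbF.
have := @class_symmetric_shift _ _ _ _ (x + 1) (2 * (2 * x + 1) + 1) c3 ltac:(lia).
rewrite expr0.
have -> : 1 * (2 * (2 * x + 1) + 1) + (hshift d - rshift d) * C + 4 * slope d * C * (x + 1) =
    hshift d * C - 1 - rshift d * C + 2 * (1 + slope d * C) * (2 * (x + 1)) by ring.
by move=> ->; addb_solve.
Qed.

Theorem checked_summary :
  [/\ [/\ fabric (weave_of d C), isonemal (weave_of d C),
          exists2 n, has_order (weave_of d C) n & (4 < n)%N
        & no_half_turn_on_strand (weave_of d C)],
      forall t, planarG1 (weave_of d C) t <-> exists s, group_of d C t s,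
      forall t, planarH1 (weave_of d C) t <-> group_of d C t (swap t),
      (vsign d -> sgn (tsign d) (vshift d %/ 2)%Z = false ->
         strand_transitive (planarH1 (weave_of d C))) /\
      (tsign d -> ~~ vsign d -> ~~ hsign d -> ~~ rsign d ->
         ~ strand_transitive (planarH1 (weave_of d C)))
    & forall m : nat, ((2 * m + 1)%N %| C)%Z ->
        perfect_colouring (weave_of d C) (strand_colour (@residue m) (@residue m))].
Proof.
case/and5P: (ok) => wf mk _ _ /and5P[_ _ _ i1 /and5P[i2 ev lamE _ /andP[kq sf]]].
case/and4P: ev => kap2 q2 p2 p0.
have half x : (2 %| x)%Z -> x * C = 2 * ((x %/ 2)%Z * C).
  by move=> x2; rewrite mulrA -{1}(divzK x2) [_ * 2]mulrC.
have sgnC s x : sgn s (x * C) = sgn s x.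
  have -> : x * C = x + 2 * (8 * (h0 * x)) by rewrite C16; ring.
  by rewrite sgnD sgn_double addbF.
have lam2 : 1 + slope d * C = 2 * ((slope d %/ 2)%Z * C) + 1.
  by rewrite addrC half //; case/orP: lamE => [/eqP->|/and4P[/eqP->]].
have [e eE se] : exists2 e, 2 * ((1 + slope d * C) * (1 + slope d * C) - 1) = vshift d * C * e
    & sgn (vsign d) e = false.
  case/orP: lamE => [/eqP->|/and4P[/eqP-> /eqP-> /negPf-> _]].
    by exists 0; [ring|rewrite sgn0].
  (* For slope 4 and p = 16 C one has 2 (l^2 - 1) = 16 C (1 + 2 C). *)
  by exists (1 + 2 * C) => //; ring.
have p4 : 4 < vshift d * C.
  have C0 : 0 <= C by apply: le_trans (ltW C80).
  by apply: lt_le_trans (ler_peMl C0 p0); apply: lt_trans C80.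
have kqE : hshift d * C * (1 + (1 + slope d * C)) - 2 * (rshift d * C) =
    vshift d * C * ((2 * hshift d - 2 * rshift d) %/ vshift d)%Z.
  have -> : vshift d * C * ((2 * hshift d - 2 * rshift d) %/ vshift d)%Z =
    ((2 * hshift d - 2 * rshift d) %/ vshift d)%Z * vshift d * C by ring.
  rewrite divzK //.
  by case/orP: lamE => [/eqP->|/and4P[_ _ _ /eqP->]]; ring.
have sfE : sgn (vsign d) ((2 * hshift d - 2 * rshift d) %/ vshift d)%Z = sgn (tsign d) ((hshift d %/ 2)%Z * C).
  by rewrite sgnC; apply/eqP.
have inc1 : incomparable w (hshift d * C - 1 + 2 * (1 + slope d * C)) (hsign d (+) tsign d).
  have -> : hshift d * C - 1 + 2 * (1 + slope d * C) = (hshift d + 2 * slope d) * C + 1 by ring.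
  exact: (symbolic_incomparableP C16 C80 wf).
have inc2 : incomparable w (hshift d * C - 1) (hsign d).
  exact: (symbolic_incomparableP C16 C80 wf).
have [h1 h2 h3 [h4 h5] h6] := weave_summary lam2 (half _ kap2) (half _ q2)
  (half _ p2) p4 word_period eE se kqE sfE word_even word_odd
  (word_shift_dvdz C16 C80 wf mk) (word_chiral C16 C80 wf mk) inc1 inc2.
split=> //; first by split=> // sv st; apply: h4; rewrite ?sgnC.
move=> m cC; apply: h6; rewrite ?dvdz_mull //.
by rewrite addrAC subrr add0r dvdz_mull.
Qed.

End Checked.

(* Found by computer search: [o] is light and [x] is dark. *)
Local Notation o := false.
Local Notation x := true.

Definition species11 := WeaveData
  (WordData [:: o; o; x; x; o; o; x; x; o; o; x; x; o; o; x; x] 4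
     [:: (1, -3); (1, 3)])
  false false true false 0 0 2 4
  [:: o; x; o; o; x; x; x] (1, -3).

Definition species13 := WeaveData
  (WordData [:: o; o; o; o; o; o; o; o; o; o; o; o; o; o; o; o] 4
     [:: (1, -2); (3, -3); (3, -2); (3, 3)])
  false false false false 0 0 2 4
  [:: x; x; o; o; o; o; x] (3, -3).

Definition species15 := WeaveData
  (WordData [:: o; x; o; o; o; x; o; o; o; x; o; o; o; x; o; o] 4
     [:: (0, -6); (0, -3); (2, -3); (2, 6)])
  false true false false 0 0 2 4
  [:: o; o; o; o; x; o] (0, -3).

Definition species17 := WeaveData
  (WordData [:: o; o; o; o; o; o; o; o; o; o; o; o; o; o; o; o] 4
     [:: (0, -2); (0, 2); (0, 5); (2, 5)])
  false false false false 0 2 0 4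
  [:: x; o; o; x; o; o; o; o] (0, 2).

Definition species19 := WeaveData
  (WordData [:: o; x; o; o; o; x; o; o; o; x; o; o; o; x; o; o] 4
     [:: (0, -6); (0, 0); (0, 6)])
  false true false false 0 2 0 4
  [:: x; o; o; x; o; o; o] (0, 6).

Definition species21 := WeaveData
  (WordData [:: o; o; o; x; x; x; x; o; o; o; o; x; x; x; x; o] 8
     [:: (0, 0); (4, 0)])
  true false false true 0 2 0 4
  [:: o; x; x; o; o; o] (4, 0).

Definition species22 := WeaveData
  (WordData [:: o; o; x; o; o; x; o; o; o; o; x; o; o; x; o; o] 8
     [:: (2, 1); (6, 1)])
  true false false false 0 4 0 8
  [:: x; o; x; o; o; o] (2, 1).

Definition species25 := WeaveData
  (WordData [:: o; o; o; o; o; o; o; o; o; o; o; o; o; o; o; o] 4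
     [:: (2, -2); (2, -1); (2, 2)])
  false false false false 0 0 0 4
  [:: x; x; o; o; x; o] (2, -2).

Definition species27 := WeaveData
  (WordData [:: o; o; o; o; o; o; o; o; o; o; o; o; o; o; o; o] 4
     [:: (1, -1); (1, 1); (1, 6); (3, -1); (3, 1); (3, 6)])
  false false false false 0 0 0 2
  [:: o; o; x; o; o; o; o; o] (1, 4).

Definition species29 := WeaveData
  (WordData [:: o; o; x; x; o; o; x; x; o; o; x; x; o; o; x; x] 4
     [:: (0, -5); (2, -5)])
  false false false true 0 0 0 2
  [:: o; o; o; x; x; o] (0, -5).

Definition species30 := WeaveData
  (WordData [:: o; o; o; o; o; o; x; o; o; x; o; o; o; x; x; o] 16
     [:: (6, -3)])
  true false false false 4 0 0 16
  [:: x; o; o; o; o; x; o] (6, -8).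



(** When only R carries a sign, the sign of an element is its [swap], so every symmetry preserves
    sides. *)
Lemma group_full (l k q' p' : int) t :
  weave_group false false true false l k q' p' t (swap t) <->
  exists s, weave_group false false true false l k q' p' t s.
Proof.
split=> [|[s [a [b [nE xE yE sE]]]]]; first by exists (swap t).
by exists a, b; split.
Qed.

(** * The eleven species *)

Section Species.

Variables (C h0 : int).
Hypotheses (C16 : C = 1 + 16 * h0) (C80 : 80 < C).

Lemma types_weave_of d T T' : checked d ->
  of_crystallographic_type (fun t => exists s, group_of d C t s) T ->
  of_crystallographic_type (fun t => group_of d C t (swap t)) T' ->
  types_G1_H1 (weave_of d C) T T'.
Proof.
move=> /(checked_summary C16 C80)[_ gE hE _ _] hT hT'.
by split; apply: of_crystallographic_type_iff; [exact: gE| |exact: hE|].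
Qed.

Let C0 : C != 0. Proof. by lia. Qed.
Let CE : C = 2 * (8 * h0) + 1. Proof. by rewrite C16; ring. Qed.

(** The tests in [checked] do not mention C, so one computation per species serves every C; the
    group is then one of the shapes above. *)
Lemma weave_of_roth_type n :
  n \in [:: 11; 13; 15; 17; 19; 21; 22; 25; 27; 29; 30]%N ->
  exists2 d, checked d & roth_type n (weave_of d C).
Proof.
have no_half d : checked d -> no_half_turn_on_strand (weave_of d C).
  by move=> /(checked_summary C16 C80)[[]].
rewrite !inE; do ! case/predU1P=> [->|]; last move/eqP->.
- have ok : checked species11 by vm_compute.
  exists species11; [exact: ok|split; first exact: no_half].
  apply: types_weave_of ok _ _; rewrite /group_of /= !mul0r addr0 CE.
    exact: G1_pgg.
  apply: of_crystallographic_type_iff (G1_pgg _ _ _ _ (8 * h0)) => t.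
  exact: group_full.
- have ok : checked species13 by vm_compute.
  exists species13; [exact: ok|split; first exact: no_half].
  apply: types_weave_of ok _ _; rewrite /group_of /= !mul0r addr0.
    by rewrite CE; apply: G1_pgg.
  by apply: H1_p2; lia.
- have ok : checked species15 by vm_compute.
  exists species15; [exact: ok|split; first exact: no_half].
  apply: types_weave_of ok _ _; rewrite /group_of /= !mul0r addr0.
    by rewrite CE; apply: G1_pgg.
  by apply: H1_pg => //; lia.
- have ok : checked species17 by vm_compute.
  exists species17; [exact: ok|split; first exact: no_half].
  apply: types_weave_of ok _ _; rewrite /group_of /= !mul0r addr0.
    exact: G1_pmg.
  by apply: H1_p2; lia.
- have ok : checked species19 by vm_compute.
  exists species19; [exact: ok|split; first exact: no_half].
  apply: types_weave_of ok _ _; rewrite /group_of /= !mul0r addr0.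
    exact: G1_pmg.
  by apply: H1_pg => //; lia.
- have ok : checked species21 by vm_compute.
  exists species21; [exact: ok|split; first exact: no_half].
  split; last first.
    by have [_ _ _ [tr _] _] := checked_summary C16 C80 ok; apply: tr.
  apply: types_weave_of ok _ _; rewrite /group_of /= !mul0r addr0.
    exact: G1_pmg.
  by apply: H1_pgg_of_pmg => //; lia.
- have ok : checked species22 by vm_compute.
  exists species22; [exact: ok|split; first exact: no_half].
  split; last first.
    by have [_ _ _ [_ ntr] _] := checked_summary C16 C80 ok; apply: ntr.
  apply: types_weave_of ok _ _; rewrite /group_of /= !mul0r addr0.
    (* This is the pmg shape with B = 2 C even, so that V carries no sign and H1 is not
       transitive. *)
    have -> : 4 * C = 2 * (2 * C) by ring.
    have -> : 8 * C = 4 * (2 * C) by ring.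
    by apply: G1_pmg; lia.
  have -> : 4 * C = 2 * (2 * C) by ring.
  have -> : 8 * C = 4 * (2 * C) by ring.
  by apply: H1_pgg_of_pmg => //; lia.
- have ok : checked species25 by vm_compute.
  exists species25; [exact: ok|split; first exact: no_half].
  apply: types_weave_of ok _ _; rewrite /group_of /= !mul0r addr0.
    exact: G1_pmm.
  by apply: H1_p2; lia.
- have ok : checked species27 by vm_compute.
  exists species27; [exact: ok|split; first exact: no_half].
  apply: types_weave_of ok _ _; rewrite /group_of /= !mul0r addr0.
    by rewrite CE; apply: G1_cmm.
  by apply: H1_p2; lia.
- have ok : checked species29 by vm_compute.
  exists species29; [exact: ok|split; first exact: no_half].
  split; last first.
    by have [_ _ _ [tr _] _] := checked_summary C16 C80 ok; apply: tr.
  apply: types_weave_of ok _ _; rewrite /group_of /= !mul0r addr0 CE.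
    exact: G1_cmm.
  exact: H1_pgg_of_cmm.
- have ok : checked species30 by vm_compute.
  exists species30; [exact: ok|split; first exact: no_half].
  split; last first.
    by have [_ _ _ [_ ntr] _] := checked_summary C16 C80 ok; apply: ntr.
  apply: types_weave_of ok _ _; rewrite /group_of /= !mul0r.
    exact: G1_cmm_sparse.
  exact: H1_pgg_of_cmm_sparse.
Qed.

End Species.

(** With T = m (m + 1) / 2, c^2 = 1 + 8 T and c^4 = 1 + 16 (T + 4 T^2). The bound is tight, since
    3^4 = 81. *)
Lemma odd_fourth_power (m : nat) : (1 <= m)%N ->
  exists2 h : int, ((2 * m + 1)%N%:Z) ^+ 4 = 1 + 16 * h & 80 < (2 * m + 1)%N%:Z ^+ 4.
Proof.
move=> m1; have [T TE] : exists T : nat, (m * (m + 1) = 2 * T)%N.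
  exists (m * (m + 1))./2; have := odd_double_half (m * (m + 1)).
  by rewrite oddM oddD addbT andbN mul2n.
have E : (2 * m + 1)%N%:Z ^+ 2 = 1 + 8 * T%:Z.
  by rewrite -[_ ^+ 2]/(_ * _) -PoszM; nia.
exists (T%:Z + 4 * T%:Z ^+ 2).
  by rewrite -[4%N]/(2 * 2)%N exprM E; ring.
have T1 : (1 <= T)%N by nia.
by rewrite -[4%N]/(2 * 2)%N exprM E; nia.
Qed.

Local Close Scope ring_scope.

Theorem theorem4 (m n : nat) (hm : (1 <= m)%N)
    (hn : n \in [:: 11; 13; 15; 17; 19; 21; 22; 25; 27; 29; 30]) :
  exists W : prefabric,
    [/\ fabric W,
        isonemal_of_species n W
      & exists cw cf : int -> 'I_(2 * m + 1),
          [/\ (forall x, exists a, cw a = x),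
              (forall x, exists b, cf b = x),
              perfect_colouring W (strand_colour cw cf)
            & redundancy_doubled_twill cw cf (2 * m + 1)]].
Proof.
have [h C16 C80] := odd_fourth_power hm.
have [d ok roth] := weave_of_roth_type C16 C80 hn.
have [[fab iso ord _] _ _ _ perf] := checked_summary C16 C80 ok.
exists (weave_of d ((2 * m + 1)%N%:Z ^+ 4)%R); split=> //.
exists (@residue m), (@residue m); split.
- exact: residue_surj.
- exact: residue_surj.
- by apply: perf; rewrite exprS dvdz_mulr.
- exact: residue_doubled_twill.
Qed.
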